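(* Let $(M,g)$ and $(N,h)$ be Riemannian manifolds and let $F:(M,g)\to(N,h)$ be a horizontally conformal submersion with dilation $\lambda$. If the O'Neill tensor $A$ of $F$ is parallel, then $\lambda$ is constant on $\mathrm{Ker}F_\ast$.
   Context: A horizontally conformal submersion with dilation $\lambda$ is a surjective smooth submersion $F:(M,g)\to(N,h)$ between Riemannian manifolds together with a smooth function $\lambda:M\to\mathbb{R}^+$ such that $h(F_\ast X,F_\ast Y)=\lambda^2(p)\,g(X,Y)$ for all $p\in M$ and all $X,Y\in(\mathrm{Ker}F_{\ast p})^\perp$. Let $\mathcal{H}$ and $\nu$ denote the orthogonal projections of $TM$ onto the horizontal distribution $(\mathrm{Ker}F_\ast)^\perp$ and the vertical distribution $\mathrm{Ker}F_\ast$, and let $\nabla$ be the Levi-Civita connection of $g$. The O'Neill tensor $A$ is $A_EE'=\mathcal{H}\nabla_{\mathcal{H}E}\nu E'+\nu\nabla_{\mathcal{H}E}\mathcal{H}E'$ for $E,E'\in\Gamma(TM)$. It is parallel if $\nabla A=0$, where $(\nabla_EA)_{E'}E''=\nabla_E(A_{E'}E'')-A_{\nabla_EE'}E''-A_{E'}(\nabla_EE'')$. ''$\lambda$ is constant on $\mathrm{Ker}F_\ast$'' means that the vertical part of the gradient of $\lambda$ (equivalently of $1/\lambda^2$) vanishes, i.e. $V(\lambda)=0$ for every vertical vector $V$. *)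

(* Defs.v *)
From mathcomp Require Import all_boot all_order all_algebra.
From mathcomp Require Import all_classical all_reals all_analysis.
Set Implicit Arguments.
Unset Strict Implicit.
Unset Printing Implicit Defensive.
Import Order.TTheory GRing.Theory Num.Theory numFieldNormedType.Exports.
Local Open Scope classical_set_scope.
Local Open Scope ring_scope.

(* C^k maps on an open set U of a finite-dimensional space: f is C^(k+1) when
   it is differentiable on U and each x |-> 'd f x v is C^k; in finite
   dimension this is the same as asking that x |-> 'd f x be C^k. *)
Fixpoint Ck_on (R : realType) (V W : normedModType R) (k : nat)
    (U : set V) (f : V -> W) : Prop :=
  match k with
  | 0%N => forall x, U x -> {for x, continuous f}
  | k'.+1 => (forall x, U x -> differentiable f x) /\
             (forall v : V, Ck_on k' U (fun x => 'd f x v))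
  end.

Definition smooth_on (R : realType) (V W : normedModType R)
    (U : set V) (f : V -> W) : Prop :=
  forall k, Ck_on k U f.

(* [cmap] is only meaningful on [cdom], and [cinv] on [cmap @` cdom]. *)
Record chart (R : realType) (n : nat) (T : topologicalType) := Chart {
  cdom : set T ;
  cmap : T -> 'rV[R]_n ;
  cinv : 'rV[R]_n -> T ;
  open_cdom : open cdom ;
  open_cimg : open (cmap @` cdom) ;
  cmapK : forall p, cdom p -> cinv (cmap p) = p ;
  continuous_cmap : forall p, cdom p -> {for p, continuous cmap} ;
  continuous_cinv : forall x, (cmap @` cdom) x -> {for x, continuous cinv} }.

Record manifold (R : realType) (n : nat) := Manifold {
  carrier :> topologicalType ;
  manifold_hausdorff : hausdorff_space carrier ;
  manifold_second_countable : @second_countable carrier ;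
  atlas : set (chart R n carrier) ;
  atlas_cover : forall p : carrier, exists c, atlas c /\ cdom c p ;
  atlas_smooth : forall c d, atlas c -> atlas d ->
    smooth_on (cmap c @` (cdom c `&` cdom d)) (cmap d \o cinv c) }.

Definition chart_at (R : realType) (n : nat) (M : manifold R n) (p : M) :
    chart R n M :=
  projT1 (cid (atlas_cover p)).

(* T_p M is represented by 'rV[R]_n through the chart [chart_at p]: a tangent
   vector at p is its row of coordinates in that chart.  [tcoord] and [tvec]
   convert to and from coordinates in another chart c around p, by means of the
   differentials of the transition maps at p. *)
Definition tcoord (R : realType) (n : nat) (M : manifold R n)
    (c : chart R n M) (p : M) (v : 'rV[R]_n) : 'rV[R]_n :=
  'd (cmap c \o cinv (chart_at p)) (cmap (chart_at p) p) v.

Definition tvec (R : realType) (n : nat) (M : manifold R n)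
    (c : chart R n M) (p : M) (u : 'rV[R]_n) : 'rV[R]_n :=
  'd (cmap (chart_at p) \o cinv c) (cmap c p) u.

Definition smooth_fun (R : realType) (n : nat) (M : manifold R n)
    (f : M -> R) : Prop :=
  forall c, atlas c -> smooth_on (cmap c @` cdom c) (f \o cinv c).

Definition smooth_map (R : realType) (m n : nat)
    (M : manifold R m) (N : manifold R n) (F : M -> N) : Prop :=
  continuous F /\
  forall c d, atlas c -> atlas d ->
    smooth_on (cmap c @` (cdom c `&` F @^-1` cdom d))
              (cmap d \o F \o cinv c).

Definition dfun (R : realType) (n : nat) (M : manifold R n)
    (f : M -> R) (p : M) (v : 'rV[R]_n) : R :=
  'd (f \o cinv (chart_at p)) (cmap (chart_at p) p) v.

Definition dmap (R : realType) (m n : nat) (M : manifold R m)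
    (N : manifold R n) (F : M -> N) (p : M) (v : 'rV[R]_m) : 'rV[R]_n :=
  'd (cmap (chart_at (F p)) \o F \o cinv (chart_at p)) (cmap (chart_at p) p) v.

Definition vfield (R : realType) (n : nat) (M : manifold R n) : Type :=
  M -> 'rV[R]_n.

Definition smooth_vfield (R : realType) (n : nat) (M : manifold R n)
    (X : vfield M) : Prop :=
  forall c, atlas c ->
    smooth_on (cmap c @` cdom c)
              (fun x => tcoord c (cinv c x) (X (cinv c x))).

Definition vderiv (R : realType) (n : nat) (M : manifold R n)
    (X : vfield M) (f : M -> R) : M -> R :=
  fun p => dfun f p (X p).

Record riemannian (R : realType) (n : nat) (M : manifold R n) := Riemannian {
  metric :> M -> 'rV[R]_n -> 'rV[R]_n -> R ;
  metric_linear : forall p a u v w,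
    metric p (a *: u + v) w = a * metric p u w + metric p v w ;
  metric_sym : forall p u v, metric p u v = metric p v u ;
  metric_posdef : forall p u, u != 0 -> 0 < metric p u u ;
  metric_smooth : forall c, atlas c -> forall u v : 'rV[R]_n,
    smooth_on (cmap c @` cdom c)
      (fun x => metric (cinv c x) (tvec c (cinv c x) u)
                                  (tvec c (cinv c x) v)) }.

(* Operators on vector fields are total functions on [vfield M]; only their
   values at smooth vector fields matter. *)
Definition affine_connection (R : realType) (n : nat) (M : manifold R n)
    (nabla : vfield M -> vfield M -> vfield M) : Prop :=
  [/\ forall X Y, smooth_vfield X -> smooth_vfield Y ->
        smooth_vfield (nabla X Y),
      forall (f : M -> R) X X' Y, smooth_fun f -> smooth_vfield X ->
        smooth_vfield X' -> smooth_vfield Y ->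
        forall p, nabla (fun q => f q *: X q + X' q) Y p =
                  f p *: nabla X Y p + nabla X' Y p,
      forall X Y Y', smooth_vfield X -> smooth_vfield Y -> smooth_vfield Y' ->
        forall p, nabla X (fun q => Y q + Y' q) p =
                  nabla X Y p + nabla X Y' p
    & forall (f : M -> R) X Y, smooth_fun f -> smooth_vfield X ->
        smooth_vfield Y ->
        forall p, nabla X (fun q => f q *: Y q) p =
                  f p *: nabla X Y p + vderiv X f p *: Y p].

Definition is_lie_bracket (R : realType) (n : nat) (M : manifold R n)
    (X Y Z : vfield M) : Prop :=
  forall f, smooth_fun f -> forall p,
    vderiv Z f p = vderiv X (vderiv Y f) p - vderiv Y (vderiv X f) p.

Definition torsion_free (R : realType) (n : nat) (M : manifold R n)
    (nabla : vfield M -> vfield M -> vfield M) : Prop :=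
  forall X Y, smooth_vfield X -> smooth_vfield Y ->
    is_lie_bracket X Y (fun p => nabla X Y p - nabla Y X p).

Definition metric_compatible (R : realType) (n : nat) (M : manifold R n)
    (g : riemannian M) (nabla : vfield M -> vfield M -> vfield M) : Prop :=
  forall X Y Z, smooth_vfield X -> smooth_vfield Y -> smooth_vfield Z ->
    forall p, vderiv X (fun q => g q (Y q) (Z q)) p =
              g p (nabla X Y p) (Z p) + g p (Y p) (nabla X Z p).

Definition levi_civita (R : realType) (n : nat) (M : manifold R n)
    (g : riemannian M) (nabla : vfield M -> vfield M -> vfield M) : Prop :=
  [/\ affine_connection nabla, torsion_free nabla & metric_compatible g nabla].

Definition orth (R : realType) (n : nat) (M : manifold R n)
    (g : riemannian M) (p : M) (W : set 'rV[R]_n) : set 'rV[R]_n :=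
  [set u | forall w, W w -> g p u w = 0].

(* The u in W with v - u orthogonal to W; it exists and is unique when W is a
   linear subspace. *)
Definition orth_proj (R : realType) (n : nat) (M : manifold R n)
    (g : riemannian M) (p : M) (W : set 'rV[R]_n) (v : 'rV[R]_n) : 'rV[R]_n :=
  get [set u | W u /\ orth g p W (v - u)].

Definition vertical (R : realType) (m n : nat) (M : manifold R m)
    (N : manifold R n) (F : M -> N) (p : M) : set 'rV[R]_m :=
  [set v | dmap F p v = 0].

Definition horizontal (R : realType) (m n : nat) (M : manifold R m)
    (N : manifold R n) (g : riemannian M) (F : M -> N) (p : M) :
    set 'rV[R]_m :=
  orth g p (vertical F p).

Definition submersion (R : realType) (m n : nat) (M : manifold R m)
    (N : manifold R n) (F : M -> N) : Prop :=
  smooth_map F /\ forall p (w : 'rV[R]_n), exists v, dmap F p v = w.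

Definition horizontally_conformal_submersion (R : realType) (m n : nat)
    (M : manifold R m) (N : manifold R n) (g : riemannian M)
    (h : riemannian N) (F : M -> N) (lambda : M -> R) : Prop :=
  [/\ submersion F,
      forall q, exists p, F p = q,
      smooth_fun lambda,
      forall p, 0 < lambda p
    & forall p u v, horizontal g F p u -> horizontal g F p v ->
        h (F p) (dmap F p u) (dmap F p v) = lambda p ^+ 2 * g p u v].

Definition hpart (R : realType) (m n : nat) (M : manifold R m)
    (N : manifold R n) (g : riemannian M) (F : M -> N) (E : vfield M) :
    vfield M :=
  fun p => orth_proj g p (horizontal g F p) (E p).

Definition vpart (R : realType) (m n : nat) (M : manifold R m)
    (N : manifold R n) (g : riemannian M) (F : M -> N) (E : vfield M) :
    vfield M :=
  fun p => orth_proj g p (vertical F p) (E p).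

Definition oneill_A (R : realType) (m n : nat) (M : manifold R m)
    (N : manifold R n) (g : riemannian M) (F : M -> N)
    (nabla : vfield M -> vfield M -> vfield M) (E E' : vfield M) : vfield M :=
  fun p => hpart g F (nabla (hpart g F E) (vpart g F E')) p
         + vpart g F (nabla (hpart g F E) (hpart g F E')) p.

Definition cov_deriv (R : realType) (n : nat) (M : manifold R n)
    (nabla : vfield M -> vfield M -> vfield M)
    (A : vfield M -> vfield M -> vfield M) (E E' E'' : vfield M) : vfield M :=
  fun p => nabla E (A E' E'') p - A (nabla E E') E'' p - A E' (nabla E E'') p.

Definition parallel_tensor (R : realType) (n : nat) (M : manifold R n)
    (nabla : vfield M -> vfield M -> vfield M)
    (A : vfield M -> vfield M -> vfield M) : Prop :=
  forall E E' E'', smooth_vfield E -> smooth_vfield E' -> smooth_vfield E'' ->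
    forall p, cov_deriv nabla A E E' E'' p = 0.

Definition constant_on_kernel (R : realType) (m n : nat) (M : manifold R m)
    (N : manifold R n) (F : M -> N) (f : M -> R) : Prop :=
  forall p v, vertical F p v -> dfun f p v = 0.

(* Main.v *)
Require Import Defs.
From mathcomp Require Import all_boot all_order all_algebra.
From mathcomp Require Import all_classical all_reals all_analysis.
From mathcomp Require Import ring lra.
Set Implicit Arguments.
Unset Strict Implicit.
Unset Printing Implicit Defensive.
Import Order.TTheory GRing.Theory Num.Theory numFieldNormedType.Exports.
Local Open Scope classical_set_scope.
Local Open Scope ring_scope.

(** For a vertical field V let T_V X be the horizontal part of nabla_X V, for
    X horizontal; this is A_X V.  Two facts about T_V decide the matter.

    The quadratic form of T_V is a multiple of the metric
    ([dilation_derivative]):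
      V(lambda) g(X, X) = - lambda g(nabla_X V, X)   for X horizontal.
    Indeed lambda^2 g(X, X) = h(F_* X, F_* X).  Differentiate along V.  The
    coefficients of h in coordinates y_i of N are constant along the fibres,
    and the component X(y_i o F) of F_* X has V-derivative [V, X](y_i o F),
    because V(y_i o F) = 0.  So the right-hand side has derivative
    2 h(F_* [V, X], F_* X) = 2 lambda^2 g([V, X], X), while the left-hand side
    has derivative 2 lambda V(lambda) g(X, X) + 2 lambda^2 g(nabla_V X, X); the
    difference nabla_V X - [V, X] is nabla_X V.

    If A is parallel then T_V o T_V = 0: since A_V = 0, the derivative
    (nabla_X A)_V V reduces to - A_(nabla_X V) V = - T_V (T_V X).

    Suppose V(lambda) <> 0 at p.  By the first fact T_V X = 0 forces X = 0 at p,
    so T_V is injective there; as T_V o T_V = 0, every horizontal vector at p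
    vanishes.  But the horizontal space is isomorphic to the tangent space of
    N, which is not zero.

    A connection and its properties only speak of globally defined smooth
    fields, so the pointwise argument needs every vertical or horizontal vector
    to extend to a global smooth vertical or horizontal field.  Plateau
    functions ([bump_manifold]) extend a vector to a smooth field
    ([vector_extension]) and the coordinates y_i to smooth functions
    ([coord_extension]); projecting keeps fields smooth because the projection
    is given in charts by a matrix whose entries are rational functions of the
    metric coefficients and of the Jacobian of F ([hproj_mx], [smooth_hpart]). *)

(** * Calculus of smooth maps between normed spaces *)
Section Calculus.
Context {R : realType}.
Implicit Types U V W : normedModType R.

(** The differential is chosen by a description operator, so locality
    has to be recovered from the uniqueness of the first-order expansion. *)
Lemma near_eq_diff V W (f g : V -> W) (x : V) :
  (\forall y \near x, f y = g y) -> differentiable f x ->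
  differentiable g x /\ 'd g x = 'd f x :> (V -> W).
Proof.
move=> fg df.
have [dfc /eqaddoP dfo] := (diff_locallyP x f).1 df.
have H : g \o shift x = cst (g x) + 'd f x +o_ 0 id.
  apply/eqaddoP => e e0; near=> h.
  have -> : (g \o shift x - (cst (g x) + 'd f x)) h =
            (f \o shift x - (cst (f x) + 'd f x)) h.
    rewrite !fctE /= (nbhs_singleton fg); congr (_ - _).
    suff -> : f (h + x) = g (h + x) by [].
    by near: h; move: fg; rewrite (near_shift 0) subr0.
  by near: h; apply: dfo.
have E := diff_unique dfc H; split; last exact: E.
by apply/diff_locallyP; rewrite E; split.
Unshelve. all: by end_near. Qed.

Lemma diffD_at V W (f g : V -> W) x v : differentiable f x -> differentiable g x ->
  'd (fun y => f y + g y) x v = 'd f x v + 'd g x v.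
Proof.
move=> fd gd.
have E := diffD fd gd.
exact: (congr1 (fun h : V -> W => h v) E).
Qed.

Lemma diffM_at V (f g : V -> R) x v : differentiable f x -> differentiable g x ->
  'd (fun y => f y * g y) x v = f x * 'd g x v + g x * 'd f x v.
Proof.
move=> fd gd.
have E := diffM fd gd.
exact: (congr1 (fun h : V -> R => h v) E).
Qed.

Lemma diffV_at V (f : V -> R) x v : differentiable f x -> f x != 0 ->
  'd (fun y => (f y)^-1) x v = -1 * ((f x)^-1 * (f x)^-1 * 'd f x v).
Proof.
move=> fd f0.
have E := diffV fd f0.
transitivity (- (f x) ^- 2 * 'd f x v); first exact: (congr1 (fun h : V -> R => h v) E).
by rewrite -exprVn expr2 mulN1r mulNr.
Qed.

Lemma diff_comp_at U V W (f : U -> V) (g : V -> W) (x v : U) :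
  differentiable f x -> differentiable g (f x) ->
  'd (g \o f) x v = 'd g (f x) ('d f x v).
Proof.
move=> fd gd; have E := diff_comp fd gd.
exact: (congr1 (fun h : U -> W => h v) E).
Qed.

Lemma Ck_on_sub V W k (U U' : set V) (f : V -> W) :
  U `<=` U' -> Ck_on k U' f -> Ck_on k U f.
Proof.
elim: k f => [|k IH] f sUU /=; first by move=> fc x /sUU/fc.
by case=> fd dfC; split=> [x /sUU/fd //|v]; apply: IH.
Qed.

(** Openness is essential: the differentials on [U] depend on the values of the
    functions near [U]. *)
Lemma Ck_on_eq V W k (U : set V) (f g : V -> W) : open U ->
  (forall x, U x -> f x = g x) -> Ck_on k U f -> Ck_on k U g.
Proof.
move=> oU; elim: k f g => [|k IH] f g fg /=.
  move=> fc x Ux; have := fc x Ux; rewrite /prop_for /continuous_at (fg _ Ux).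
  apply: cvg_trans; apply: near_eq_cvg.
  by near=> y; apply: fg; near: y; exact: open_nbhs_nbhs.
have near_fg x : U x -> \forall y \near x, f y = g y.
  by move=> Ux; near=> y; apply: fg; near: y; exact: open_nbhs_nbhs.
case=> fd dfC; split=> [x Ux|v].
  exact: (near_eq_diff (near_fg x Ux) (fd x Ux)).1.
apply: IH (dfC v) => x Ux.
by rewrite (near_eq_diff (near_fg x Ux) (fd x Ux)).2.
Unshelve. all: by end_near. Qed.

Lemma Ck_on_local V W k (U : set V) (f : V -> W) :
  (forall x, U x -> exists2 O, O x & Ck_on k O f) -> Ck_on k U f.
Proof.
elim: k f => [|k IH] f H /=.
  by move=> x /H[B Bx /(_ _ Bx)].
split=> [x /H[B Bx [+ _]]|v]; first by apply.
by apply: IH => x /H[B Bx [_ /(_ v)]]; exists B.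
Qed.

Lemma Ck_onS V W k (U : set V) (f : V -> W) : Ck_on k.+1 U f -> Ck_on k U f.
Proof.
elim: k f => [|k IH] f.
  by case=> fd _ x /fd; exact: differentiable_continuous.
by case=> fd dfC; split=> // v; apply: IH; exact: dfC.
Qed.

Lemma Ck_on_cst V W k (U : set V) (c : W) : Ck_on k U (fun _ => c).
Proof.
elim: k c => [|k IH] c /=; first by move=> x _; exact: cst_continuous.
split=> [x _|v]; first exact: differentiable_cst.
rewrite (_ : (fun x => _) = fun _ => 0) ?funeqE//.
by move=> x; rewrite (diff_cst (c : W) x).
Qed.

Lemma Ck_onD V W k (U : set V) (f g : V -> W) : open U ->
  Ck_on k U f -> Ck_on k U g -> Ck_on k U (fun x => f x + g x).
Proof.
move=> oU; elim: k f g => [|k IH] f g.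
  by move=> fC gC x Ux; apply: continuousD; [exact: fC|exact: gC].
case=> fd fC [gd gC]; split=> [x Ux|v].
  by apply: differentiableD; [exact: fd|exact: gd].
apply: Ck_on_eq (IH _ _ (fC v) (gC v)) => // x Ux.
by rewrite diffD_at //; [exact: fd|exact: gd].
Qed.

Lemma Ck_onM V k (U : set V) (f g : V -> R) : open U ->
  Ck_on k U f -> Ck_on k U g -> Ck_on k U (fun x => f x * g x).
Proof.
move=> oU; elim: k f g => [|k IH] f g.
  by move=> fC gC x Ux; apply: continuousM; [exact: fC|exact: gC].
move=> fCk gCk; have [fd fC] := fCk; have [gd gC] := gCk; split=> [x Ux|v].
  by apply: differentiableM; [exact: fd|exact: gd].
apply: Ck_on_eq (Ck_onD oU (IH _ _ (Ck_onS fCk) (gC v))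
                           (IH _ _ (Ck_onS gCk) (fC v))) => // x Ux.
by rewrite diffM_at //; [exact: fd|exact: gd].
Qed.

Lemma Ck_onZl V W k (U : set V) (f : V -> R) (w : W) : open U ->
  Ck_on k U f -> Ck_on k U (fun x => f x *: w).
Proof.
move=> oU; elim: k f => [|k IH] f.
  move=> fC x Ux; exact/continuousZr_tmp/fC.
case=> fd fC; split=> [x Ux|v]; first exact/differentiableZl/fd.
apply: Ck_on_eq (IH _ (fC v)) => // x Ux.
apply/esym; exact: (congr1 (fun h : V -> W => h v) (diffZl w (fd _ Ux))).
Qed.

Lemma Ck_onV V k (U : set V) (f : V -> R) : open U ->
  (forall x, U x -> f x != 0) ->
  Ck_on k U f -> Ck_on k U (fun x => (f x)^-1).
Proof.
move=> oU f0; elim: k => [|k IH].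
  by move=> fC x Ux; apply: continuousV; [exact: f0|exact: fC].
move=> fCk; have [fd fC] := fCk; split=> [x Ux|v].
  by apply: differentiableV; [exact: fd|exact: f0].
have fVC := IH (Ck_onS fCk).
apply: Ck_on_eq (Ck_onM oU (Ck_on_cst k U (-1 : R))
  (Ck_onM oU (Ck_onM oU fVC fVC) (fC v))) => // x Ux.
by rewrite diffV_at //; [exact: fd|exact: f0].
Qed.

Lemma diff_coord V n (f : V -> 'rV[R]_n) x v i : differentiable f x ->
  'd (fun t => f t 0 i) x v = 'd f x v 0 i.
Proof.
move=> fd; have dc := differentiable_coord (f x) 0 i.
rewrite -!deriveE //; last exact: (differentiable_comp fd dc).
by rewrite derive_mx ?mxE //; exact: diff_derivable.
Qed.

Lemma differentiable_coords V n (f : V -> 'rV[R]_n) x :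
  differentiable f x -> forall i, differentiable (fun t => f t 0 i) x.
Proof.
by move=> fd i; apply: (differentiable_comp fd (differentiable_coord (f x) 0 i)).
Qed.

Lemma Ck_on_coord V n k (U : set V) (f : V -> 'rV[R]_n) i : open U ->
  Ck_on k U f -> Ck_on k U (fun x => f x 0 i).
Proof.
move=> oU; elim: k f => [|k IH] f.
  move=> fC x Ux; apply: (@continuous_comp _ _ _ f (fun M => M 0 i)).
    exact: fC.
  exact: coord_continuous.
case=> fd fC; split=> [x /fd/differentiable_coords //|v].
by apply: Ck_on_eq (IH _ (fC v)) => // x Ux; rewrite diff_coord //; exact: fd.
Qed.

Lemma Ck_on_sum V W k (U : set V) n (f : 'I_n -> V -> W) : open U ->
  (forall i, Ck_on k U (f i)) -> Ck_on k U (fun x => \sum_i f i x).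
Proof.
move=> oU; elim: n f => [|n IH] f fC.
  by under eq_fun do rewrite big_ord0; exact: Ck_on_cst.
by under eq_fun do rewrite big_ord_recl; apply: Ck_onD => //; exact: IH.
Qed.

Lemma Ck_on_row V n k (U : set V) (f : V -> 'rV[R]_n) : open U ->
  (forall i, Ck_on k U (fun x => f x 0 i)) -> Ck_on k U f.
Proof.
move=> oU fC.
have -> : f = fun x => \sum_i f x 0 i *: delta_mx 0 i :> 'rV_n.
  by apply/funext => x; exact: row_sum_delta.
by apply: Ck_on_sum => // i; apply: Ck_onZl.
Qed.

Lemma diff_row_sum n W (g : 'rV[R]_n -> W) y (w : 'rV[R]_n) :
  'd g y w = \sum_i w 0 i *: 'd g y (delta_mx 0 i).
Proof.
rewrite {1}[w]row_sum_delta linear_sum; apply: eq_bigr => i _.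
by rewrite linearZ.
Qed.

(** The chain rule expresses the differential of the composite as a sum, over a
    basis of the intermediate space, of products of functions that are one
    degree less regular; this is where that space has to be finite
    dimensional. *)
Lemma Ck_on_comp1 V n k (U : set V) (O : set 'rV[R]_n) (f : V -> 'rV[R]_n)
    (g : 'rV[R]_n -> R) : open U -> (forall x, U x -> O (f x)) ->
  Ck_on k U f -> Ck_on k O g -> Ck_on k U (g \o f).
Proof.
move=> oU fUO; elim: k g => [|k IH] g.
  by move=> fC gC x Ux; exact: (continuous_comp (fC _ Ux) (gC _ (fUO _ Ux))).
move=> fCk [gd gC]; have [fd fC] := fCk; split=> [x Ux|v].
  exact: differentiable_comp (fd _ Ux) (gd _ (fUO _ Ux)).
have H i : Ck_on k U (fun x => 'd f x v 0 i * 'd g (f x) (delta_mx 0 i)).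
  exact: Ck_onM oU (Ck_on_coord i oU (fC v)) (IH _ (Ck_onS fCk) (gC _)).
apply: Ck_on_eq (Ck_on_sum oU H) => // x Ux.
by rewrite (diff_comp_at _ (fd _ Ux) (gd _ (fUO _ Ux))) [RHS]diff_row_sum.
Qed.

Lemma smooth_on_sub V W (U U' : set V) (f : V -> W) :
  U `<=` U' -> smooth_on U' f -> smooth_on U f.
Proof. by move=> sU fC k; apply: Ck_on_sub (fC k). Qed.

Lemma smooth_on_eq V W (U : set V) (f g : V -> W) : open U ->
  (forall x, U x -> f x = g x) -> smooth_on U f -> smooth_on U g.
Proof. by move=> oU fg fC k; apply: Ck_on_eq (fC k). Qed.

Lemma smooth_on_local V W (U : set V) (f : V -> W) :
  (forall x, U x -> exists2 O, O x & smooth_on O f) -> smooth_on U f.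
Proof.
by move=> H k; apply: Ck_on_local => x /H[B Bx fC]; exists B => //; exact: fC.
Qed.

Lemma smooth_on_cst V W (U : set V) (c : W) : smooth_on U (fun _ => c).
Proof. by move=> k; exact: Ck_on_cst. Qed.

Lemma smooth_onD V W (U : set V) (f g : V -> W) : open U ->
  smooth_on U f -> smooth_on U g -> smooth_on U (fun x => f x + g x).
Proof. by move=> oU fC gC k; apply: Ck_onD. Qed.

Lemma smooth_onM V (U : set V) (f g : V -> R) : open U ->
  smooth_on U f -> smooth_on U g -> smooth_on U (fun x => f x * g x).
Proof. by move=> oU fC gC k; apply: Ck_onM. Qed.

Lemma smooth_onV V (U : set V) (f : V -> R) : open U ->
  (forall x, U x -> f x != 0) ->
  smooth_on U f -> smooth_on U (fun x => (f x)^-1).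
Proof. by move=> oU f0 fC k; apply: Ck_onV. Qed.

Lemma smooth_on_coord V n (U : set V) (f : V -> 'rV[R]_n) i : open U ->
  smooth_on U f -> smooth_on U (fun x => f x 0 i).
Proof. by move=> oU fC k; apply: Ck_on_coord. Qed.

Lemma smooth_on_row V n (U : set V) (f : V -> 'rV[R]_n) : open U ->
  (forall i, smooth_on U (fun x => f x 0 i)) -> smooth_on U f.
Proof. by move=> oU fC k; apply: Ck_on_row => // i; exact: fC. Qed.

Lemma smooth_on_sum V W (U : set V) (I : Type) (r : seq I) (P : pred I)
    (f : I -> V -> W) : open U ->
  (forall i, smooth_on U (f i)) -> smooth_on U (fun x => \sum_(i <- r | P i) f i x).
Proof.
move=> oU fC; elim: r => [|i r IH].
  by under eq_fun do rewrite big_nil; exact: smooth_on_cst.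
under eq_fun do rewrite big_cons.
by case: (P i) => //; apply: smooth_onD.
Qed.

Lemma smooth_on_prod V (U : set V) (I : Type) (r : seq I) (P : pred I)
    (f : I -> V -> R) : open U ->
  (forall i, smooth_on U (f i)) -> smooth_on U (fun x => \prod_(i <- r | P i) f i x).
Proof.
move=> oU fC; elim: r => [|i r IH].
  by under eq_fun do rewrite big_nil; exact: smooth_on_cst.
under eq_fun do rewrite big_cons.
by case: (P i) => //; apply: smooth_onM.
Qed.

Lemma smooth_on_comp1 V n (U : set V) (O : set 'rV[R]_n) (f : V -> 'rV[R]_n)
    (g : 'rV[R]_n -> R) : open U -> (forall x, U x -> O (f x)) ->
  smooth_on U f -> smooth_on O g -> smooth_on U (g \o f).
Proof. by move=> oU fUO fC gC k; apply: (Ck_on_comp1 oU fUO). Qed.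

Lemma smooth_on_diff V W (U : set V) (f : V -> W) v :
  smooth_on U f -> smooth_on U (fun x => 'd f x v).
Proof. by move=> fC k; have [_] := fC k.+1; exact. Qed.

Lemma smooth_on_differentiable V W (U : set V) (f : V -> W) x :
  smooth_on U f -> U x -> differentiable f x.
Proof. by move=> fC Ux; have [+ _] := fC 1%N; exact. Qed.

Lemma smooth_on_det V n (U : set V) (A : V -> 'M[R]_n) : open U ->
  (forall i j, smooth_on U (fun x => A x i j)) -> smooth_on U (fun x => \det (A x)).
Proof.
move=> oU AC; apply: smooth_on_sum => // s; apply: smooth_onM => //.
  exact: smooth_on_cst.
exact: smooth_on_prod.
Qed.

Lemma smooth_on_mulmx V n p q (U : set V) (A : V -> 'M[R]_(n, p))
    (B : V -> 'M[R]_(p, q)) i j : open U ->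
  (forall i j, smooth_on U (fun x => A x i j)) ->
  (forall i j, smooth_on U (fun x => B x i j)) ->
  smooth_on U (fun x => (A x *m B x) i j).
Proof.
move=> oU AC BC; under eq_fun do rewrite mxE.
by apply: smooth_on_sum => // k; apply: smooth_onM.
Qed.

(** By Cramer's formula the inverse is rational in the entries. *)
Lemma smooth_on_invmx V n (U : set V) (A : V -> 'M[R]_n) i j : open U ->
  (forall x, U x -> A x \in unitmx) ->
  (forall i j, smooth_on U (fun x => A x i j)) ->
  smooth_on U (fun x => invmx (A x) i j).
Proof.
move=> oU Au AC.
apply: (@smooth_on_eq _ _ _ (fun x => (\det (A x))^-1 * \adj (A x) i j)) => //.
  by move=> x Ux; rewrite /invmx Au // !mxE.
apply: smooth_onM => //.
  apply: smooth_onV => //; last exact: smooth_on_det.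
  by move=> x Ux; rewrite -unitfE -unitmxE; exact: Au.
under eq_fun do rewrite mxE.
apply: smooth_onM => //; first exact: smooth_on_cst.
by apply: smooth_on_det => // k l; under eq_fun do rewrite !mxE; exact: AC.
Qed.

End Calculus.

(** * Tangent vectors and differentials in arbitrary charts *)
Section Charts.
Context {R : realType}.

Section OneChart.
Context {n : nat} {T : topologicalType} (c : chart R n T).

Lemma cimg_dom x : (cmap c @` cdom c) x -> cdom c (cinv c x).
Proof. by case=> p cp <-; rewrite cmapK. Qed.

Lemma cinvK x : (cmap c @` cdom c) x -> cmap c (cinv c x) = x.
Proof. by case=> p cp <-; rewrite cmapK. Qed.

Lemma cimg_map p : cdom c p -> (cmap c @` cdom c) (cmap c p).
Proof. by move=> cp; exists p. Qed.

Lemma cimg_setI (B : set T) :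
  cmap c @` (cdom c `&` B) = [set x | (cmap c @` cdom c) x /\ B (cinv c x)].
Proof.
apply/seteqP; split=> [x [p [cp Bp] <-]|x [ux Bx]] /=.
  by rewrite cmapK //; split=> //; exists p.
by exists (cinv c x); [split=> //; exact: cimg_dom|exact: cinvK].
Qed.

Lemma near_cinv p (P : set T) : cdom c p -> (\forall q \near p, P q) ->
  \forall y \near cmap c p, P (cinv c y).
Proof.
move=> cp nP; apply: (continuous_cinv (cimg_map cp)).
by rewrite cmapK.
Qed.

Lemma open_cimgI (B : set T) : open B -> open (cmap c @` (cdom c `&` B)).
Proof.
move=> oB; rewrite cimg_setI openE => x [ux Bx].
rewrite /interior; apply: filterI.
  by apply: open_nbhs_nbhs; split=> //; exact: open_cimg.
rewrite -{1}(cinvK ux); apply: near_cinv; first exact: cimg_dom.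
exact: open_nbhs_nbhs.
Qed.

End OneChart.

Section Manifold.
Context {n : nat} {M : manifold R n}.
Implicit Types (p q : M) (c d e : chart R n M).

Lemma chart_at_atlas p : atlas (chart_at p).
Proof. by rewrite /chart_at; case: cid => c []. Qed.

Lemma chart_at_dom p : cdom (chart_at p) p.
Proof. by rewrite /chart_at; case: cid => c []. Qed.

Lemma near_cdom c p : cdom c p -> \forall q \near p, cdom c q.
Proof. by move=> cp; apply: open_nbhs_nbhs; split=> //; exact: open_cdom. Qed.

Lemma transition_diff c d p : atlas c -> atlas d -> cdom c p -> cdom d p ->
  differentiable (cmap d \o cinv c) (cmap c p).
Proof.
move=> ac ad cp dp; apply: (smooth_on_differentiable (atlas_smooth ac ad)).
by exists p.
Qed.

(** Tangent vectors, functions and maps are all read in the distinguished chart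
    at each point, which varies in an uncontrolled way.  This chain rule moves
    any differential to a chart that is fixed near the point. *)
Lemma diff_change_chart (W : normedModType R) (f : M -> W) c d p v :
  atlas c -> atlas d -> cdom c p -> cdom d p ->
  differentiable (f \o cinv d) (cmap d p) ->
  differentiable (f \o cinv c) (cmap c p) /\
  'd (f \o cinv c) (cmap c p) v =
  'd (f \o cinv d) (cmap d p) ('d (cmap d \o cinv c) (cmap c p) v).
Proof.
move=> ac ad cp dp fd.
have td := transition_diff ac ad cp dp.
have E : (cmap d \o cinv c) (cmap c p) = cmap d p by rewrite /= cmapK.
have fd' : differentiable (f \o cinv d) ((cmap d \o cinv c) (cmap c p)).
  by rewrite E.
have near_eq : \forall y \near cmap c p,
    ((f \o cinv d) \o (cmap d \o cinv c)) y = (f \o cinv c) y.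
  near=> y; rewrite /= cmapK //; near: y.
  exact: near_cinv cp (near_cdom dp).
have [H1 H2] := near_eq_diff near_eq (differentiable_comp td fd').
split; first exact: H1.
refine (etrans (congr1 (fun h : 'rV[R]_n -> W => h v) H2) _).
refine (etrans (diff_comp_at v td fd') _).
exact: (congr1 (fun z => 'd (f \o cinv d) z _) E).
Unshelve. all: by end_near. Qed.

Lemma transition_id c p v : atlas c -> cdom c p ->
  'd (cmap c \o cinv c) (cmap c p) v = v.
Proof.
move=> ac cp.
have near_eq : \forall y \near cmap c p, id y = (cmap c \o cinv c) y.
  near=> y; rewrite /= cinvK //; near: y.
  by apply: open_nbhs_nbhs; split; [exact: open_cimg|exact: cimg_map].
have did := is_diff_id (cmap c p).
have [_ H] := near_eq_diff near_eq (@ex_diff _ _ _ _ _ _ _ did).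
refine (etrans (congr1 (fun h : 'rV[R]_n -> 'rV[R]_n => h v) H) _).
exact: (congr1 (fun h : 'rV[R]_n -> 'rV[R]_n => h v) (@diff_val _ _ _ _ _ _ _ did)).
Unshelve. all: by end_near. Qed.

Lemma tcoord_change c d p v : atlas c -> atlas d -> cdom c p -> cdom d p ->
  'd (cmap d \o cinv c) (cmap c p) (tcoord c p v) = tcoord d p v.
Proof.
move=> ac ad cp dp; have td := transition_diff ac ad cp dp.
by have [_ <-] := diff_change_chart v (chart_at_atlas p) ac (chart_at_dom p) cp td.
Qed.

Lemma tcoordK c p v : atlas c -> cdom c p -> tvec c p (tcoord c p v) = v.
Proof.
move=> ac cp; rewrite /tvec tcoord_change //; last first.
- exact: chart_at_dom.
- exact: chart_at_atlas.
- by rewrite /tcoord transition_id //; [exact: chart_at_atlas|exact: chart_at_dom].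
Qed.

Lemma tvecK c p u : atlas c -> cdom c p -> tcoord c p (tvec c p u) = u.
Proof.
move=> ac cp.
have td := transition_diff (chart_at_atlas p) ac (chart_at_dom p) cp.
have [_ E] := diff_change_chart u ac (chart_at_atlas p) cp (chart_at_dom p) td.
by rewrite /tcoord /tvec -E transition_id.
Qed.

Lemma tcoordD c p u v : tcoord c p (u + v) = tcoord c p u + tcoord c p v.
Proof. exact: linearD. Qed.

Lemma tcoordB c p u v : tcoord c p (u - v) = tcoord c p u - tcoord c p v.
Proof. exact: linearB. Qed.

Lemma tcoordZ c p a v : tcoord c p (a *: v) = a *: tcoord c p v.
Proof. exact: linearZ. Qed.

Lemma tcoord0 c p : tcoord c p 0 = 0.
Proof. exact: linear0. Qed.

Lemma tcoord_inj c p u v : atlas c -> cdom c p ->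
  tcoord c p u = tcoord c p v -> u = v.
Proof. by move=> ac cp E; rewrite -(tcoordK u ac cp) E tcoordK. Qed.

Definition mdifferentiable (f : M -> R) p :=
  differentiable (f \o cinv (chart_at p)) (cmap (chart_at p) p).

Lemma dfun_chart (f : M -> R) c p v : atlas c -> cdom c p -> mdifferentiable f p ->
  dfun f p v = 'd (f \o cinv c) (cmap c p) (tcoord c p v).
Proof.
move=> ac cp fd.
have [fc _] := diff_change_chart v ac (chart_at_atlas p) cp (chart_at_dom p) fd.
by have [_ <-] := diff_change_chart v (chart_at_atlas p) ac (chart_at_dom p) cp fc.
Qed.

Lemma mdifferentiable_chart (f : M -> R) c p : atlas c -> cdom c p ->
  differentiable (f \o cinv c) (cmap c p) -> mdifferentiable f p.
Proof.
move=> ac cp fd.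
by have [] := diff_change_chart 0 (chart_at_atlas p) ac (chart_at_dom p) cp fd.
Qed.

Lemma smooth_fun_mdifferentiable (f : M -> R) p : smooth_fun f -> mdifferentiable f p.
Proof.
move=> fC; apply: (smooth_on_differentiable (fC _ (chart_at_atlas p))).
exact/cimg_map/chart_at_dom.
Qed.

Lemma dfun_near (f f' : M -> R) p v : (\forall q \near p, f q = f' q) ->
  mdifferentiable f p -> mdifferentiable f' p /\ dfun f' p v = dfun f p v.
Proof.
move=> ff fd.
have [H1 H2] := near_eq_diff (near_cinv (chart_at_dom p) ff) fd.
by split; [exact: H1|rewrite /dfun H2].
Qed.

Lemma mdifferentiable_cst (a : R) p : mdifferentiable (fun _ => a) p.
Proof. exact: differentiable_cst. Qed.

Lemma dfun_cst (a : R) p v : dfun (fun _ : M => a) p v = 0.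
Proof.
exact: (congr1 (fun h : 'rV[R]_n -> R => h v)
  (diff_cst (V := 'rV[R]_n) (a : R) (cmap (chart_at p) p))).
Qed.

Lemma mdifferentiableD (f f' : M -> R) p : mdifferentiable f p -> mdifferentiable f' p ->
  mdifferentiable (fun q => f q + f' q) p.
Proof. exact: differentiableD. Qed.

Lemma mdifferentiableM (f f' : M -> R) p : mdifferentiable f p -> mdifferentiable f' p ->
  mdifferentiable (fun q => f q * f' q) p.
Proof. exact: differentiableM. Qed.

Lemma dfunD (f f' : M -> R) p v : mdifferentiable f p -> mdifferentiable f' p ->
  dfun (fun q => f q + f' q) p v = dfun f p v + dfun f' p v.
Proof. exact: diffD_at. Qed.

Lemma dfunM (f f' : M -> R) p v : mdifferentiable f p -> mdifferentiable f' p ->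
  dfun (fun q => f q * f' q) p v = f p * dfun f' p v + f' p * dfun f p v.
Proof.
move=> fd fd'; rewrite /dfun (diffM_at _ fd fd') /=.
by rewrite !cmapK //; exact: chart_at_dom.
Qed.

Lemma mdifferentiable_sum k (f : 'I_k -> M -> R) p : (forall i, mdifferentiable (f i) p) ->
  mdifferentiable (fun q => \sum_i f i q) p.
Proof.
elim: k f => [|k IH] f fd.
  by under eq_fun do rewrite big_ord0; exact: mdifferentiable_cst.
by under eq_fun do rewrite big_ord_recl; apply: mdifferentiableD => //; exact: IH.
Qed.

Lemma dfun_sum k (f : 'I_k -> M -> R) p v : (forall i, mdifferentiable (f i) p) ->
  dfun (fun q => \sum_i f i q) p v = \sum_i dfun (f i) p v.
Proof.
elim: k f => [|k IH] f fd.
  by under eq_fun do rewrite big_ord0; rewrite big_ord0 dfun_cst.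
under eq_fun do rewrite big_ord_recl.
rewrite big_ord_recl dfunD //; last exact: mdifferentiable_sum.
by rewrite IH.
Qed.

Lemma smooth_vderiv (X : vfield M) (f : M -> R) :
  smooth_vfield X -> smooth_fun f -> smooth_fun (vderiv X f).
Proof.
move=> XC fC c ac; have oc := @open_cimg _ _ _ c.
apply: (@smooth_on_eq _ _ _ _ (fun x => \sum_i
   tcoord c (cinv c x) (X (cinv c x)) 0 i *
   'd (f \o cinv c) x (delta_mx 0 i))) => //.
  move=> x ux; have cx := cimg_dom ux.
  rewrite /= /vderiv (dfun_chart _ ac cx) //; last exact: smooth_fun_mdifferentiable.
  by rewrite [RHS]diff_row_sum cinvK.
apply: smooth_on_sum => // i; apply: smooth_onM => //.
  exact: (smooth_on_coord i oc (XC c ac)).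
exact: smooth_on_diff (fC c ac).
Qed.

End Manifold.

Section Maps.
Context {m n : nat} {M : manifold R m} {N : manifold R n}.
Context (F : M -> N) (FC : smooth_map F).

Lemma open_pre (B : set N) : open B -> open (F @^-1` B).
Proof. by move=> oB; apply: open_comp => // x _; exact: FC.1. Qed.

Lemma near_pre (P : set N) p : (\forall q \near F p, P q) ->
  \forall q \near p, P (F q).
Proof. exact: FC.1. Qed.

Lemma map_diff c d p : atlas c -> atlas d -> cdom c p -> cdom d (F p) ->
  differentiable (cmap d \o F \o cinv c) (cmap c p).
Proof.
move=> ac ad cp dp; apply: (smooth_on_differentiable (FC.2 _ _ ac ad)).
by exists p.
Qed.

(** Same principle in the target: a function on [N] pulled back by [F] is
    differentiated through any pair of charts. *)
Lemma diff_comp_chart (W : normedModType R) (f : N -> W) c d p v :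
  atlas c -> atlas d -> cdom c p -> cdom d (F p) ->
  differentiable (f \o cinv d) (cmap d (F p)) ->
  differentiable ((f \o F) \o cinv c) (cmap c p) /\
  'd ((f \o F) \o cinv c) (cmap c p) v =
  'd (f \o cinv d) (cmap d (F p)) ('d (cmap d \o F \o cinv c) (cmap c p) v).
Proof.
move=> ac ad cp dp fd.
have td := map_diff ac ad cp dp.
have E : (cmap d \o F \o cinv c) (cmap c p) = cmap d (F p) by rewrite /= cmapK.
have fd' : differentiable (f \o cinv d) ((cmap d \o F \o cinv c) (cmap c p)).
  by rewrite E.
have near_eq : \forall y \near cmap c p,
    ((f \o cinv d) \o (cmap d \o F \o cinv c)) y = ((f \o F) \o cinv c) y.
  near=> y; rewrite /= cmapK //; near: y.
  apply: (near_cinv (P := fun q => cdom d (F q)) cp).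
  exact: near_pre (near_cdom dp).
have [H1 H2] := near_eq_diff near_eq (differentiable_comp td fd').
split; first exact: H1.
refine (etrans (congr1 (fun h : 'rV[R]_m -> W => h v) H2) _).
refine (etrans (diff_comp_at v td fd') _).
exact: (congr1 (fun z => 'd (f \o cinv d) z _) E).
Unshelve. all: by end_near. Qed.

Lemma dmap_chart c d p v : atlas c -> atlas d -> cdom c p -> cdom d (F p) ->
  'd (cmap d \o F \o cinv c) (cmap c p) (tcoord c p v) =
  tcoord d (F p) (dmap F p v).
Proof.
move=> ac ad cp dp.
have td := transition_diff (chart_at_atlas (F p)) ad (chart_at_dom (F p)) dp.
have [_ H2] := diff_comp_chart v (chart_at_atlas p) (chart_at_atlas (F p))
  (chart_at_dom p) (chart_at_dom (F p)) td.
have fc : differentiable ((cmap d \o F) \o cinv c) (cmap c p).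
  exact: map_diff ac ad cp dp.
have [_ H1] := diff_change_chart v (chart_at_atlas p) ac (chart_at_dom p) cp fc.
exact: etrans (esym H1) H2.
Qed.

Lemma dfun_comp (f : N -> R) p v : mdifferentiable f (F p) ->
  mdifferentiable (f \o F) p /\ dfun (f \o F) p v = dfun f (F p) (dmap F p v).
Proof.
move=> fd.
exact: (diff_comp_chart v (chart_at_atlas p) (chart_at_atlas (F p))
  (chart_at_dom p) (chart_at_dom (F p)) fd).
Qed.

Lemma dmapB p u v : dmap F p (u - v) = dmap F p u - dmap F p v.
Proof. exact: linearB. Qed.

Lemma dmap0 p : dmap F p 0 = 0.
Proof. exact: linear0. Qed.

Lemma smooth_fun_comp (f : N -> R) : smooth_fun f -> smooth_fun (f \o F).
Proof.
move=> fC c ac; apply: smooth_on_local => x ux.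
have cx := cimg_dom ux; set p := cinv c x in cx.
have ad := chart_at_atlas (F p); have dp := chart_at_dom (F p).
set d := chart_at (F p) in ad dp.
exists (cmap c @` (cdom c `&` F @^-1` cdom d)).
  by rewrite cimg_setI.
have oU : open (cmap c @` (cdom c `&` F @^-1` cdom d)).
  by apply/open_cimgI/open_pre/open_cdom.
have FU y : (cmap c @` (cdom c `&` F @^-1` cdom d)) y ->
    (cmap d @` cdom d) ((cmap d \o F \o cinv c) y).
  by rewrite cimg_setI => -[uy dy]; exact: cimg_map.
apply: smooth_on_eq (smooth_on_comp1 oU FU (FC.2 c d ac ad) (fC d ad)) => //.
by move=> y; rewrite cimg_setI => -[uy dy] /=; rewrite cmapK.
Qed.

End Maps.
End Charts.

(** * A smooth plateau function on a coordinate space *)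
Section Plateau.
Context {R : realType}.

(** The functions t^(-j) exp(-1/t), extended by zero to t <= 0.  Their linear
    span is closed under differentiation, which makes an induction on the degree
    of regularity possible. *)
Definition expNV (j : nat) (t : R) : R :=
  if 0 < t then t^-1 ^+ j * expR (- t^-1) else 0.

Lemma expNV_gt0 j t : 0 < t -> 0 < expNV j t.
Proof.
by move=> t0; rewrite /expNV t0 mulr_gt0 ?expR_gt0// exprn_gt0// invr_gt0.
Qed.

Lemma expNV_ge0 j t : 0 <= expNV j t.
Proof.
by rewrite /expNV; case: ifPn => // t0; rewrite mulr_ge0 ?expR_ge0// exprn_ge0// invr_ge0 ltW.
Qed.

Lemma expNV_eq0 j t : t <= 0 -> expNV j t = 0.
Proof. by move=> t0; rewrite /expNV ltNge t0. Qed.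

(** A quadratic bound is what gives a zero derivative at the origin.  It comes
    from exp(s) = exp(s/N)^N >= (s/N)^N with s = 1/t and N = j + 2. *)
Lemma expNV_le j t : expNV j t <= (j.+2 ^ j.+2)%:R * t ^+ 2.
Proof.
rewrite /expNV; case: ifPn => t0; last by rewrite mulr_ge0 ?sqr_ge0.
set s := t^-1; have s0 : 0 < s by rewrite invr_gt0.
have -> : t = s^-1 by rewrite invrK.
set N := j.+2; have N0 : 0 < N%:R :> R by rewrite ltr0n.
have H : (s / N%:R) ^+ N <= expR s.
  have -> : expR s = expR (s / N%:R) ^+ N.
    by rewrite -expRM_natl mulrC divfK // gt_eqF.
  have sN0 : 0 <= s / N%:R by rewrite divr_ge0 ?ltW.
  apply: lerXn2r; rewrite ?nnegrE ?expR_ge0 //.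
  by apply: le_trans (expR_ge1Dx _); rewrite lerDr ler01.
rewrite expRN ler_pdivrMr ?expR_gt0 //.
have C0 : 0 <= (N ^ N)%:R * s^-1 ^+ 2 :> R.
  by rewrite mulr_ge0 ?exprn_ge0 // ?invr_ge0 ltW.
apply: le_trans (ler_wpM2l C0 H).
rewrite expr_div_n natrX exprVn.
have sn0 : s != 0 by rewrite gt_eqF.
have Nn0 : N%:R ^+ N != 0 :> R by rewrite expf_neq0 // gt_eqF.
rewrite [leRHS](_ : _ = s ^+ N / s ^+ 2); last first.
  by move: Nn0; move: (_ ^+ N) (s ^+ N) => a c a0; field; rewrite a0 sn0.
by rewrite /N -(addn2 j) exprD mulfK // expf_neq0.
Qed.

Lemma is_derive_exprV j (t : R) : t != 0 ->
  is_derive t 1 (fun s : R => s^-1 ^+ j) (- (j%:R * t^-1 ^+ j.+1)).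
Proof.
move=> t0; elim: j => [|j IH].
  rewrite mul0r oppr0.
  apply: (near_eq_is_derive (f := fun _ : R => 1 : R)).
  by near=> s; rewrite expr0.
have DV : is_derive t 1 (fun s : R => s^-1) (- t ^- 2 *: 1).
  exact: (is_deriveV (f := id) t0 (is_derive_id t 1)).
apply: (near_eq_is_derive (f := (fun s : R => s^-1) * (fun s : R => s^-1 ^+ j))).
  by near=> s; rewrite exprS.
apply: is_derive_eq (is_deriveM DV IH) _.
rewrite /GRing.scale /= mulr1 -exprVn !exprS expr0 -natr1.
ring.
Unshelve. all: by end_near. Qed.

Lemma is_derive_expNV j (t : R) :
  is_derive t 1 (expNV j) (expNV j.+2 t - j%:R * expNV j.+1 t).
Proof.
have [t0|t0|->] := ltgtP t 0.
- rewrite !expNV_eq0 ?ltW // mulr0 subr0.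
  apply: (near_eq_is_derive (f := fun _ : R => 0 : R)).
  by near=> s; rewrite expNV_eq0 //; apply: ltW; near: s; exact: lt_nbhsl.
- have tn0 : t != 0 by rewrite gt_eqF.
  apply: (near_eq_is_derive (f := (fun s => s^-1 ^+ j) * (expR \o (fun s => - s^-1)))).
    near=> s; rewrite /expNV ifT //; near: s; exact: lt_nbhsr.
  rewrite /expNV t0.
  have DV : is_derive t 1 (fun s : R => - s^-1) (- (- t ^- 2 *: 1)).
    exact: (is_deriveN (is_deriveV (f := id) tn0 (is_derive_id t 1))).
  apply: is_derive_eq
    (is_deriveM (is_derive_exprV j tn0) (is_derive1_comp (is_derive_expR _) DV)) _.
  rewrite /GRing.scale /= mulr1 -exprVn !exprS expr0.
  ring.
- rewrite !expNV_eq0 // mulr0 subr0.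
  have H : (fun h : R => h^-1 *: ((expNV j \o shift 0) (h *: 1) - expNV j 0)) @ 0^'
      --> (0 : R).
    apply/cvgr0Pnorm_le => e e0.
    set C : R := (j.+2 ^ j.+2)%:R.
    have C0 : 0 < C by rewrite ltr0n expn_gt0.
    near=> h.
    have h0 : h != 0 by near: h; exact: nbhs_dnbhs_neq.
    rewrite /= [h *: 1]mulr1 addr0 [expNV j 0]expNV_eq0 // subr0 normrZ normfV.
    rewrite ler_pdivrMl ?normr_gt0 // ger0_norm ?expNV_ge0 //.
    apply: le_trans (expNV_le _ _) _; rewrite -/C -real_normK ?num_real // expr2.
    rewrite mulrA [leRHS]mulrC ler_wpM2r // -ler_pdivlMl // mulrC; apply: ltW.
    by near: h; apply: dnbhs0_lt; rewrite divr_gt0.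
  by split; [apply/cvg_ex; exists 0|exact: cvg_lim].
Unshelve. all: by end_near. Qed.

Lemma Ck_on_expNV (V : normedModType R) j k (U : set V) (f : V -> R) : open U ->
  Ck_on k U f -> Ck_on k U (fun x => expNV j (f x)).
Proof.
move=> oU.
have fld i t : differentiable (expNV i) t.
  by apply/derivable1_diffP; have [] := is_derive_expNV i t.
elim: k j => [|k IH] j.
  move=> fC x Ux; apply: (@continuous_comp _ _ _ f (expNV j)); first exact: fC.
  exact: differentiable_continuous.
move=> fCk; have [fd fC] := fCk; split=> [x Ux|v].
  exact: differentiable_comp (fd _ Ux) (fld _ _).
have fCk' := Ck_onS fCk.
have H := Ck_onM oU (fC v) (Ck_onD oU (IH j.+2 fCk')
   (Ck_onM oU (Ck_on_cst k U (- j%:R : R)) (IH j.+1 fCk'))).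
apply: Ck_on_eq H => // x Ux.
apply/esym; refine (etrans (diff_comp_at v (fd _ Ux) (fld j (f x))) _).
refine (etrans (congr1 (fun h : R -> R => h _) (diff1E (fld j (f x)))) _).
rewrite derive1E; have [_ ->] := is_derive_expNV j (f x).
by rewrite mulNr.
Qed.

Lemma smooth_on_expNV (V : normedModType R) j (U : set V) (f : V -> R) : open U ->
  smooth_on U f -> smooth_on U (fun x => expNV j (f x)).
Proof. by move=> oU fC k; apply: Ck_on_expNV. Qed.

Lemma smooth_on_id (V : normedModType R) (U : set V) : smooth_on U (id : V -> V).
Proof.
case=> [|k]; first by move=> x _; exact: cvg_id.
split=> [x _|v]; first exact: (@ex_diff _ _ _ _ _ _ _ (is_diff_id x)).
rewrite (_ : (fun x => _) = fun _ => v); first exact: Ck_on_cst.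
apply/funext => x.
exact: (congr1 (fun h : V -> V => h v) (@diff_val _ _ _ _ _ _ _ (is_diff_id x))).
Qed.

(** The quotient u / (u + w), where u = exp(-1/(r^2 - s)) lives on s < r^2 and
    w = exp(-1/(s - r^2/4)) on s > r^2/4, with s the squared Euclidean distance
    to [x0]: the two regions cover the space, so the denominator is positive,
    and the quotient is 1 where w vanishes and 0 where u does. *)
Lemma bump_rV n (O : set 'rV[R]_n) (x0 : 'rV[R]_n) : open O -> O x0 ->
  exists b : 'rV[R]_n -> R, exists K : set 'rV[R]_n,
    [/\ smooth_on setT b, (\forall x \near x0, b x = 1), compact K, K `<=` O
      & forall x, ~ K x -> b x = 0].
Proof.
move=> oO Ox0.
have /nbhs_normP[/= e e0 eO] : nbhs x0 O by exact: open_nbhs_nbhs.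
pose r := e / 2; have r0 : 0 < r by rewrite divr_gt0.
pose sq (x : 'rV[R]_n) := \sum_i (x 0 i - x0 0 i) * (x 0 i - x0 0 i).
have oT : open [set: 'rV[R]_n] := openT.
have sqC : smooth_on setT sq.
  apply: smooth_on_sum => // i.
  have H : smooth_on setT (fun x : 'rV[R]_n => x 0 i - x0 0 i).
    apply: smooth_onD => //; last exact: smooth_on_cst.
    exact: (smooth_on_coord i oT (@smooth_on_id _ setT)).
  exact: smooth_onM.
have sq_ge (x : 'rV[R]_n) i : (x 0 i - x0 0 i) ^+ 2 <= sq x.
  rewrite /sq (bigD1 i) //= -expr2 lerDl sumr_ge0 // => k _.
  by rewrite -expr2 sqr_ge0.
pose u (x : 'rV[R]_n) := expNV 0 (r ^+ 2 - sq x).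
pose w (x : 'rV[R]_n) := expNV 0 (sq x - r ^+ 2 / 4%:R).
have uw0 x : 0 < u x + w x.
  have [h|h] := ltP (sq x) (r ^+ 2).
    by apply: ltr_wpDr; [exact: expNV_ge0|apply: expNV_gt0; rewrite subr_gt0].
  apply: ltr_wpDl; first exact: expNV_ge0.
  apply: expNV_gt0; rewrite subr_gt0; apply: lt_le_trans h.
  by rewrite ltr_pdivrMr // ltr_pMr ?exprn_gt0 // ltr1n.
have uC : smooth_on setT u.
  apply: smooth_on_expNV => //; apply: smooth_onD => //; first exact: smooth_on_cst.
  apply: (@smooth_on_eq _ _ _ _ (fun x => -1 * sq x)) => //.
    by move=> x _; rewrite mulN1r.
  by apply: smooth_onM => //; exact: smooth_on_cst.
have wC : smooth_on setT w.
  by apply: smooth_on_expNV => //; apply: smooth_onD => //; exact: smooth_on_cst.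
exists (fun x => u x * (u x + w x)^-1), [set x : 'rV[R]_n | `|x - x0| <= r]; split.
- apply: smooth_onM => //; apply: smooth_onV => //; last exact: smooth_onD.
  by move=> x _; rewrite gt_eqF.
- have sqc : {for x0, continuous sq} := sqC 0%N x0 I.
  have sq0 : sq x0 = 0 by rewrite /sq big1 // => i _; rewrite subrr mul0r.
  have : \forall x \near x0, sq x < r ^+ 2 / 4%:R.
    apply: (sqc [set y | y < r ^+ 2 / 4%:R]).
    by rewrite sq0; apply: lt_nbhsl; rewrite divr_gt0 ?exprn_gt0.
  apply: filterS => x h; have -> : w x = 0.
    by rewrite /w expNV_eq0 // subr_le0 ltW.
  by rewrite addr0 divff // gt_eqF //; have := uw0 x; rewrite /w [expNV 0 _]expNV_eq0 ?addr0 // subr_le0 ltW.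
- apply: bounded_closed_compact.
    exists (r + `|x0|); split; first exact: num_real.
    move=> y yr x /= xr; rewrite -(subrK x0 x); apply: le_trans (ler_normD _ _) _.
    by apply: ltW; apply: le_lt_trans yr; rewrite lerD2r.
  have -> : [set x : 'rV[R]_n | `|x - x0| <= r] =
      (fun x : 'rV[R]_n => `|x - x0|) @^-1` [set t : R | t <= r] by [].
  apply: preimage_closed; last exact: closed_le.
  move=> x _; apply: continuous_comp; last exact: norm_continuous.
  by apply: continuousB; [exact: cvg_id|exact: cst_continuous].
- move=> x /= xr; apply: eO; rewrite /= distrC; apply: le_lt_trans xr _.
  by rewrite ltr_pdivrMr // ltr_pMr // ltr1n.
- move=> x /negP; rewrite -ltNge => rx.
  suff : u x = 0 by move=> ->; rewrite mul0r.
  apply: expNV_eq0; rewrite subr_le0 leNgt; apply/negP => sqx.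
  move: rx; apply/negP; rewrite -leNgt.
  have coord_le j : `|x 0 j - x0 0 j| <= r.
    rewrite -(@ler_pXn2r _ 2) ?nnegrE ?(ltW r0) // real_normK ?num_real //.
    exact: le_trans (sq_ge _ _) (ltW sqx).
  rewrite [leLHS]/Num.Def.normr /= mx_normrE; apply: bigmax_le; first exact: ltW.
  by move=> [i j] _; rewrite /= ord1 !mxE; exact: coord_le.
Qed.

End Plateau.

(** * Global smooth functions and fields *)
Section Extension.
Context {R : realType} {n : nat} {M : manifold R n}.
Implicit Types (p q : M) (c d : chart R n M).

Lemma smooth_transition_on c d (B : set M) : atlas c -> atlas d ->
  smooth_on (cmap c @` (cdom c `&` (cdom d `&` B))) (cmap d \o cinv c).
Proof.
move=> ac ad; apply: smooth_on_sub (atlas_smooth ac ad) => x [p [cp [dp _]] <-].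
by exists p.
Qed.

Lemma smooth_fun_local (f : M -> R) :
  (forall p, exists c, exists B : set M, [/\ atlas c, cdom c p, open B, B p &
    smooth_on (cmap c @` (cdom c `&` B)) (f \o cinv c)]) ->
  smooth_fun f.
Proof.
move=> H d ad; apply: smooth_on_local => x ux.
have dq := cimg_dom ux; set q := cinv d x in dq.
have [c [B [ac cq oB Bq fC]]] := H q.
pose U := cmap d @` (cdom d `&` (cdom c `&` B)).
have oU : open U by apply/open_cimgI/openI => //; exact: open_cdom.
exists U; first by rewrite /U cimg_setI.
have cU y : U y -> (cmap c @` (cdom c `&` B)) ((cmap c \o cinv d) y).
  by rewrite /U cimg_setI => -[uy [cy By]]; exists (cinv d y).
have tC := smooth_transition_on B ad ac.
apply: smooth_on_eq (smooth_on_comp1 oU cU tC fC) => //.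
by move=> y; rewrite /U cimg_setI => -[uy [cy By]] /=; rewrite cmapK.
Qed.

(** Smoothness in every chart of the atlas follows from smoothness in one chart
    near each point, since passing from one chart to another multiplies the
    components by the smooth Jacobian of a transition map. *)
Lemma smooth_vfield_local (X : vfield M) :
  (forall p, exists c, exists B : set M, [/\ atlas c, cdom c p, open B, B p &
    smooth_on (cmap c @` (cdom c `&` B))
      (fun x => tcoord c (cinv c x) (X (cinv c x)))]) ->
  smooth_vfield X.
Proof.
move=> H d ad; apply: smooth_on_local => x ux.
have dq := cimg_dom ux; set q := cinv d x in dq.
have [c [B [ac cq oB Bq XC]]] := H q.
pose U := cmap d @` (cdom d `&` (cdom c `&` B)).
have oU : open U by apply/open_cimgI/openI => //; exact: open_cdom.
exists U; first by rewrite /U cimg_setI.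
pose O1 := cmap c @` (cdom c `&` B).
have oO1 : open O1 by exact: open_cimgI.
have cU y : U y -> O1 ((cmap c \o cinv d) y).
  by rewrite /U cimg_setI => -[uy [cy By]]; exists (cinv d y).
pose O2 := cmap c @` (cdom c `&` cdom d).
have cU2 y : U y -> O2 ((cmap c \o cinv d) y).
  rewrite /U cimg_setI => -[uy [cy By]]; exists (cinv d y) => //.
  by split=> //; exact: cimg_dom.
have oO2 : open O2 by apply/open_cimgI/open_cdom.
have tC := smooth_transition_on B ad ac.
pose Xc y := tcoord c (cinv c y) (X (cinv c y)).
pose D i y := 'd (cmap d \o cinv c) y (delta_mx 0 i).
have XtC i : smooth_on U (fun y => Xc ((cmap c \o cinv d) y) 0 i).
  exact: (smooth_on_comp1 oU cU tC (smooth_on_coord i oO1 XC)).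
have DtC i j : smooth_on U (fun y => D i ((cmap c \o cinv d) y) 0 j).
  have DC : smooth_on O2 (D i) := smooth_on_diff _ (atlas_smooth ac ad).
  exact: (smooth_on_comp1 oU cU2 tC (smooth_on_coord j oO2 DC)).
apply: smooth_on_row => // j.
apply: (@smooth_on_eq _ _ _ _ (fun y => \sum_i
   Xc ((cmap c \o cinv d) y) 0 i * D i ((cmap c \o cinv d) y) 0 j)) => //.
  move=> y; rewrite /U cimg_setI => -[uy [cy By]].
  have dy := cimg_dom uy.
  rewrite -(tcoord_change _ ac ad cy dy) diff_row_sum summxE.
  by apply: eq_bigr => i _; rewrite mxE /Xc /= cmapK.
by apply: smooth_on_sum => // i; exact: smooth_onM.
Qed.

Lemma smooth_fun_cst (a : R) : smooth_fun (fun _ : M => a).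
Proof. by move=> c ac; exact: smooth_on_cst. Qed.

Lemma smooth_vfield0 : smooth_vfield (fun _ : M => 0).
Proof.
move=> c ac; under eq_fun do rewrite tcoord0; exact: smooth_on_cst.
Qed.

Lemma smooth_vfieldD (X Y : vfield M) : smooth_vfield X -> smooth_vfield Y ->
  smooth_vfield (fun p => X p + Y p).
Proof.
move=> XC YC c ac; have oc := @open_cimg _ _ _ c.
apply: smooth_on_eq (smooth_onD oc (XC c ac) (YC c ac)) => //.
by move=> x ux; rewrite -tcoordD.
Qed.

Lemma smooth_vfieldZ (f : M -> R) (X : vfield M) : smooth_fun f ->
  smooth_vfield X -> smooth_vfield (fun p => f p *: X p).
Proof.
move=> fC XC c ac; have oc := @open_cimg _ _ _ c.
apply: smooth_on_row => // j.
apply: smooth_on_eq (smooth_onM oc (fC c ac) (smooth_on_coord j oc (XC c ac))) => //.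
by move=> x ux; rewrite tcoordZ mxE.
Qed.

(** The support is compact in the chart, hence closed in the manifold by the
    Hausdorff property; extension by zero is therefore smooth. *)
Lemma bump_manifold p c : atlas c -> cdom c p -> exists b : M -> R, exists K : set M,
  [/\ smooth_fun b, (\forall q \near p, b q = 1), closed K, K `<=` cdom c
    & forall q, ~ K q -> b q = 0].
Proof.
move=> ac cp; have oc := @open_cimg _ _ _ c.
have [b [K [bC b1 cK KO b0]]] := bump_rV oc (cimg_map cp).
pose f q := if pselect (cdom c q) then b (cmap c q) else 0.
have fE q : cdom c q -> f q = b (cmap c q).
  by rewrite /f; case: pselect.
have f0 q : ~ (cinv c @` K) q -> f q = 0.
  rewrite /f; case: pselect => // cq Kq; apply: b0 => Kc; apply: Kq.
  by exists (cmap c q) => //; rewrite cmapK.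
have clK : closed (cinv c @` K).
  apply: compact_closed; first exact: manifold_hausdorff.
  apply: continuous_compact => //; apply: continuous_in_subspaceT => x.
  by rewrite inE => /KO; exact: continuous_cinv.
have Kc : cinv c @` K `<=` cdom c by move=> _ [x /KO/cimg_dom ? <-].
exists f, (cinv c @` K); split=> //.
  apply: smooth_fun_local => q; have [cq|ncq] := pselect (cdom c q).
    exists c, setT; split=> //; first exact: openT.
    rewrite setIT; apply: (@smooth_on_eq _ _ _ _ b) => //.
      by move=> x ux; rewrite /= fE ?cinvK //; exact: cimg_dom.
    exact: smooth_on_sub bC.
  exists (chart_at q), (~` (cinv c @` K)); split.
  - exact: chart_at_atlas.
  - exact: chart_at_dom.
  - exact: closed_openC.
  - by move=> /Kc.
  have oU : open (cmap (chart_at q) @` (cdom (chart_at q) `&` ~` (cinv c @` K))).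
    exact/open_cimgI/closed_openC.
  apply: (@smooth_on_eq _ _ _ _ (fun _ => 0)) => //.
    by move=> x; rewrite cimg_setI /= => -[_ nK]; rewrite f0.
  exact: smooth_on_cst.
have H := continuous_cmap cp b1.
near=> q; rewrite fE; first by near: q; exact: H.
by near: q; exact: near_cdom.
Unshelve. all: by end_near. Qed.

Lemma vector_extension p (v : 'rV[R]_n) :
  exists X : vfield M, smooth_vfield X /\ X p = v.
Proof.
have ac := chart_at_atlas p; have cp := chart_at_dom p.
set c := chart_at p in ac cp.
have [b [K [bC b1 clK Kc b0]]] := bump_manifold ac cp.
pose X : vfield M := fun q => b q *: tvec c q (tcoord c p v).
exists X; split; last by rewrite /X (nbhs_singleton b1) scale1r tcoordK.
apply: smooth_vfield_local => q; have [cq|ncq] := pselect (cdom c q).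
  exists c, setT; split=> //; first exact: openT.
  rewrite setIT; have oc := @open_cimg _ _ _ c; apply: smooth_on_row => // j.
  apply: (@smooth_on_eq _ _ _ _
    (fun x => (b \o cinv c) x * tcoord c p v 0 j)) => //.
    move=> x ux; rewrite tcoordZ tvecK ?mxE //; exact: cimg_dom.
  apply: smooth_onM => //; [exact: bC|exact: smooth_on_cst].
have oU : open (cmap (chart_at q) @` (cdom (chart_at q) `&` ~` K)).
  exact/open_cimgI/closed_openC.
exists (chart_at q), (~` K); split.
- exact: chart_at_atlas.
- exact: chart_at_dom.
- exact: closed_openC.
- by move=> /Kc.
apply: (@smooth_on_eq _ _ _ _ (fun _ => 0)) => //; last exact: smooth_on_cst.
by move=> x; rewrite cimg_setI /= => -[_ nK]; rewrite /X b0 // scale0r tcoord0.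
Qed.

Lemma coord_extension p c i : atlas c -> cdom c p ->
  exists f : M -> R, smooth_fun f /\ \forall q \near p, f q = cmap c q 0 i.
Proof.
move=> ac cp; have [b [K [bC b1 clK Kc b0]]] := bump_manifold ac cp.
pose f q := b q * cmap c q 0 i.
exists f; split; last by apply: filterS b1 => q bq; rewrite /f bq mul1r.
apply: smooth_fun_local => q; have [cq|ncq] := pselect (cdom c q).
  exists c, setT; split=> //; first exact: openT.
  rewrite setIT; have oc := @open_cimg _ _ _ c.
  apply: (@smooth_on_eq _ _ _ _ (fun x => (b \o cinv c) x * x 0 i)) => //.
    by move=> x ux; rewrite /f /= cinvK.
  apply: smooth_onM => //; first exact: bC.
  exact: (smooth_on_coord i oc (@smooth_on_id _ _ _)).
have oU : open (cmap (chart_at q) @` (cdom (chart_at q) `&` ~` K)).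
  exact/open_cimgI/closed_openC.
exists (chart_at q), (~` K); split.
- exact: chart_at_atlas.
- exact: chart_at_dom.
- exact: closed_openC.
- by move=> /Kc.
apply: (@smooth_on_eq _ _ _ _ (fun _ => 0)) => //; last exact: smooth_on_cst.
by move=> x; rewrite cimg_setI /= => -[_ nK]; rewrite /f b0 // mul0r.
Qed.

End Extension.

(** * The metric in coordinates *)
Section Metric.
Context {R : realType} {n : nat} {M : manifold R n} (g : riemannian M).
Implicit Types (p q : M) (c d : chart R n M) (u v w : 'rV[R]_n).

Lemma metricDl p u v w : g p (u + v) w = g p u w + g p v w.
Proof. by rewrite -{1}[u]scale1r metric_linear mul1r. Qed.

Lemma metric0l p w : g p 0 w = 0.
Proof.
by apply: (addrI (g p 0 w)); rewrite -metricDl !addr0.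
Qed.

Lemma metricZl p a u w : g p (a *: u) w = a * g p u w.
Proof. by rewrite -{1}[a *: u]addr0 metric_linear metric0l addr0. Qed.

Lemma metricBl p u v w : g p (u - v) w = g p u w - g p v w.
Proof. by rewrite -scaleN1r metricDl metricZl mulN1r. Qed.

Lemma metricZr p a u w : g p w (a *: u) = a * g p w u.
Proof. by rewrite !(Defs.metric_sym g p w) metricZl. Qed.

Lemma metric_suml p k (f : 'I_k -> 'rV[R]_n) w :
  g p (\sum_i f i) w = \sum_i g p (f i) w.
Proof.
elim: k f => [|k IH] f; first by rewrite !big_ord0 metric0l.
by rewrite !big_ord_recl metricDl IH.
Qed.

Lemma metric_sumr p k (f : 'I_k -> 'rV[R]_n) w :
  g p w (\sum_i f i) = \sum_i g p w (f i).
Proof. by rewrite Defs.metric_sym metric_suml; apply: eq_bigr => i _; rewrite Defs.metric_sym. Qed.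

Lemma metric_eq0 p u : g p u u = 0 -> u = 0.
Proof.
by move=> E; apply/eqP/negP => /negP/(metric_posdef g p); rewrite E ltxx.
Qed.

Definition gram_mx c (x : 'rV[R]_n) : 'M[R]_n :=
  \matrix_(i, j) g (cinv c x) (tvec c (cinv c x) (delta_mx 0 i))
                              (tvec c (cinv c x) (delta_mx 0 j)).

Lemma smooth_gram_mx c i j : atlas c -> smooth_on (cmap c @` cdom c) (fun x => gram_mx c x i j).
Proof. by move=> ac; under eq_fun do rewrite mxE; exact: metric_smooth. Qed.

Lemma metric_gram c p u v : atlas c -> cdom c p ->
  g p u v = \sum_i \sum_j
    tcoord c p u 0 i * tcoord c p v 0 j * gram_mx c (cmap c p) i j.
Proof.
move=> ac cp.
have E w : w = \sum_i tcoord c p w 0 i *: tvec c p (delta_mx 0 i).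
  by rewrite -{1}(tcoordK w ac cp) /tvec diff_row_sum.
rewrite {1}[u]E {1}[v]E metric_suml; apply: eq_bigr => i _.
rewrite metric_sumr; apply: eq_bigr => j _.
by rewrite metricZl metricZr mulrA mxE cmapK.
Qed.

Lemma gram_form c p (a b : 'rV[R]_n) : atlas c -> cdom c p ->
  (a *m gram_mx c (cmap c p) *m b^T) 0 0 = g p (tvec c p a) (tvec c p b).
Proof.
move=> ac cp; rewrite (metric_gram _ _ ac cp) !tvecK // exchange_big mxE.
apply: eq_bigr => j _; rewrite !mxE mulr_suml; apply: eq_bigr => i _.
by rewrite mulrAC.
Qed.

Lemma gram_sym c p : cdom c p -> (gram_mx c (cmap c p))^T = gram_mx c (cmap c p).
Proof. by move=> cp; apply/matrixP => i j; rewrite !mxE Defs.metric_sym. Qed.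

Lemma gram_pos c p (a : 'rV[R]_n) : atlas c -> cdom c p ->
  (a *m gram_mx c (cmap c p) *m a^T) 0 0 = 0 -> a = 0.
Proof.
move=> ac cp; rewrite gram_form // => /metric_eq0 E.
by rewrite -(tvecK a ac cp) E tcoord0.
Qed.

Lemma gram_unit c p : atlas c -> cdom c p -> gram_mx c (cmap c p) \in unitmx.
Proof.
move=> ac cp; rewrite -row_free_unit; apply: inj_row_free => a aG.
by apply: (gram_pos ac cp); rewrite aG mul0mx mxE.
Qed.

Lemma smooth_metric (X Y : vfield M) : smooth_vfield X -> smooth_vfield Y ->
  smooth_fun (fun q => g q (X q) (Y q)).
Proof.
move=> XC YC c ac; have oc := @open_cimg _ _ _ c.
apply: (@smooth_on_eq _ _ _ _ (fun x => \sum_i \sum_j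
    tcoord c (cinv c x) (X (cinv c x)) 0 i *
    tcoord c (cinv c x) (Y (cinv c x)) 0 j * gram_mx c x i j)) => //.
  move=> x ux; have cx := cimg_dom ux.
  by rewrite /= (metric_gram _ _ ac cx) cinvK.
apply: smooth_on_sum => // i; apply: smooth_on_sum => // j.
apply: smooth_onM => //; last exact: smooth_gram_mx.
by apply: smooth_onM => //; [exact: (smooth_on_coord i oc (XC c ac))
  |exact: (smooth_on_coord j oc (YC c ac))].
Qed.

Lemma orth_projE p (W : set 'rV[R]_n) u v :
  (forall a b, W a -> W b -> W (a - b)) -> W u -> orth g p W (v - u) ->
  orth_proj g p W v = u.
Proof.
move=> WB Wu vu; have ex : exists a, [set a | W a /\ orth g p W (v - a)] a by exists u.
have [Wa va] : [set a | W a /\ orth g p W (v - a)] (orth_proj g p W v).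
  exact: (getPex ex).
set a := orth_proj g p W v in Wa va *.
apply/eqP; rewrite -subr_eq0; apply/eqP/(metric_eq0 (p := p)).
have Wau := WB _ _ Wa Wu.
rewrite {1}(_ : a - u = (v - u) - (v - a)); last by rewrite opprB [RHS]addrC addrA subrK.
by rewrite metricBl vu // va // subr0.
Qed.

End Metric.

(** * Smoothness of the horizontal and vertical projections *)
Section Projections.
Context {R : realType} {m n : nat} {M : manifold R m} {N : manifold R n}.
Context (g : riemannian M) (F : M -> N) (FS : submersion F).
Let FC : smooth_map F := FS.1.
Implicit Types (p q : M) (c : chart R m M) (d : chart R n N).

Definition jacobian_in c d (x : 'rV[R]_m) : 'M[R]_(m, n) :=
  lin1_mx ('d (cmap d \o F \o cinv c) x).

Lemma jacobian_inE c d p v : atlas c -> atlas d -> cdom c p -> cdom d (F p) ->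
  tcoord c p v *m jacobian_in c d (cmap c p) = tcoord d (F p) (dmap F p v).
Proof. by move=> ac ad cp dp; rewrite mul_rV_lin1 dmap_chart. Qed.

Lemma smooth_jacobian_in c d i j : atlas c -> atlas d ->
  smooth_on (cmap c @` (cdom c `&` F @^-1` cdom d)) (fun x => jacobian_in c d x i j).
Proof.
move=> ac ad.
have oU : open (cmap c @` (cdom c `&` F @^-1` cdom d)).
  by apply/open_cimgI/(open_pre FC)/open_cdom.
under eq_fun do rewrite mxE.
exact: (smooth_on_coord j oU (smooth_on_diff _ (FC.2 _ _ ac ad))).
Qed.

(** J^T G^(-1) J is the Gram matrix of the differentials of the components of
    [F] for the dual metric; it is invertible because these differentials are
    independent. *)
Definition cometric c d x : 'M[R]_n :=
  (jacobian_in c d x)^T *m invmx (gram_mx g c x) *m jacobian_in c d x.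

(** In row-vector coordinates a vector is horizontal when it has the form
    a J^T G^(-1).  Solving z J = a J^T G^(-1) J for a yields this matrix. *)
Definition hproj_mx c d x : 'M[R]_m :=
  jacobian_in c d x *m invmx (cometric c d x) *m (jacobian_in c d x)^T *m invmx (gram_mx g c x).

Lemma cometric_unit c d p : atlas c -> atlas d -> cdom c p -> cdom d (F p) ->
  cometric c d (cmap c p) \in unitmx.
Proof.
move=> ac ad cp dp; rewrite -row_free_unit; apply: inj_row_free => y yS.
set J := jacobian_in c d (cmap c p); set G := gram_mx g c (cmap c p).
have Gu : G \in unitmx by exact: gram_unit.
pose b := y *m J^T *m invmx G.
have b0 : b = 0.
  apply: (gram_pos (g := g) ac cp); rewrite -/G mulmxKV //.
  have -> : b^T = invmx G *m J *m y^T.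
    by rewrite /b !trmx_mul trmxK trmx_inv [G^T]gram_sym // mulmxA.
  rewrite !mulmxA; move: yS; rewrite /cometric -/J -/G !mulmxA => ->.
  by rewrite mul0mx mxE.
have yJ : y *m J^T = 0 by rewrite -(mulmxKV Gu (y *m J^T)) -/b b0 mul0mx.
have [v vE] := FS.2 p (tvec d (F p) y).
have yE : tcoord c p v *m J = y by rewrite jacobian_inE // vE tvecK.
have yy : y *m y^T = 0 by rewrite -[in y^T]yE trmx_mul mulmxA yJ mul0mx.
apply/rowP => i; rewrite mxE.
have := congr1 (fun A : 'M[R]_1 => A 0 0) yy; rewrite !mxE => /eqP.
rewrite psumr_eq0 => [/allP /(_ i)|k _]; last by rewrite mxE -expr2 sqr_ge0.
by rewrite mem_index_enum mxE mulf_eq0 orbb => /(_ isT)/eqP.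
Qed.

Lemma verticalB p a b : vertical F p a -> vertical F p b -> vertical F p (a - b).
Proof. by rewrite /vertical /= => Ha Hb; rewrite dmapB Ha Hb subrr. Qed.

Lemma horizontalB p a b :
  horizontal g F p a -> horizontal g F p b -> horizontal g F p (a - b).
Proof. by move=> Ha Hb w Ww; rewrite metricBl Ha // Hb // subrr. Qed.

Lemma vertical_jacobian c d p v : atlas c -> atlas d -> cdom c p -> cdom d (F p) ->
  vertical F p v <-> tcoord c p v *m jacobian_in c d (cmap c p) = 0.
Proof.
move=> ac ad cp dp; rewrite jacobian_inE // /vertical /=; split=> [->|E].
  by rewrite tcoord0.
by apply: (tcoord_inj ad dp); rewrite E tcoord0.
Qed.

Lemma hproj_mx_split c d p v : atlas c -> atlas d -> cdom c p -> cdom d (F p) ->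
  let u := tvec c p (tcoord c p v *m hproj_mx c d (cmap c p)) in
  horizontal g F p u /\ vertical F p (v - u).
Proof.
move=> ac ad cp dp u.
set J := jacobian_in c d (cmap c p); set G := gram_mx g c (cmap c p).
have Gu : G \in unitmx by exact: gram_unit.
have Su := cometric_unit ac ad cp dp.
set S := cometric c d (cmap c p) in Su.
have uE : tcoord c p u = tcoord c p v *m J *m invmx S *m J^T *m invmx G.
  by rewrite /u tvecK // /hproj_mx -/J -/G -/S !mulmxA.
split.
  move=> k /(vertical_jacobian k ac ad cp dp); rewrite -/J => kJ.
  rewrite -(tcoordK u ac cp) -(tcoordK k ac cp) -gram_form // uE -/G mulmxKV //.
  by rewrite -mulmxA -trmx_mul kJ trmx0 mulmx0 mxE.
apply/(vertical_jacobian _ ac ad cp dp); rewrite tcoordB mulmxBl uE -/J.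
move: (tcoord c p v *m J) => A.
have -> : A *m invmx S *m J^T *m invmx G *m J = A *m invmx S *m S.
  by rewrite {2}/S /cometric -/J -/G !mulmxA.
by rewrite mulmxKV // subrr.
Qed.

Lemma split_unique p v u : horizontal g F p u -> vertical F p (v - u) ->
  orth_proj g p (horizontal g F p) v = u /\
  orth_proj g p (vertical F p) v = v - u.
Proof.
move=> hu vu; split.
  apply: orth_projE => //; first exact: horizontalB.
  by move=> w hw; rewrite Defs.metric_sym hw.
apply: orth_projE => //; first exact: verticalB.
by rewrite subKr.
Qed.

Lemma orth_proj_split p v :
  let u := orth_proj g p (horizontal g F p) v in
  [/\ horizontal g F p u, vertical F p (v - u) &
      orth_proj g p (vertical F p) v = v - u].
Proof.
have [hu vu] := hproj_mx_split v (chart_at_atlas p) (chart_at_atlas (F p))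
  (chart_at_dom p) (chart_at_dom (F p)).
by have [E1 E2] := split_unique hu vu; rewrite /= E1; split.
Qed.

Lemma horizontal_hpart (X : vfield M) p : horizontal g F p (hpart g F X p).
Proof. by have [] := orth_proj_split p (X p). Qed.

Lemma vertical_vpart (X : vfield M) p : vertical F p (vpart g F X p).
Proof. by rewrite /vpart; have [_ H ->] := orth_proj_split p (X p). Qed.

Lemma hpart_add_vpart (X : vfield M) p : X p = hpart g F X p + vpart g F X p.
Proof. by rewrite /vpart; have [_ _ ->] := orth_proj_split p (X p); rewrite addrC subrK. Qed.

Lemma split_vertical (X : vfield M) p : vertical F p (X p) ->
  hpart g F X p = 0 /\ vpart g F X p = X p.
Proof.
move=> vX; have h0 : horizontal g F p 0 by move=> w _; rewrite metric0l.
rewrite /hpart /vpart.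
by have [] := @split_unique p (X p) 0 h0; rewrite subr0.
Qed.

(** The projection is chosen pointwise; it is smooth since in charts around any
    point it is multiplication by [hproj_mx]. *)
Lemma smooth_hpart (X : vfield M) : smooth_vfield X -> smooth_vfield (hpart g F X).
Proof.
move=> XC; apply: smooth_vfield_local => p.
have ac := chart_at_atlas p; have cp := chart_at_dom p.
set c := chart_at p in ac cp.
have ad := chart_at_atlas (F p); have dp := chart_at_dom (F p).
set d := chart_at (F p) in ad dp.
have oB : open (F @^-1` cdom d) by apply/(open_pre FC)/open_cdom.
exists c, (F @^-1` cdom d); split=> //.
set U := cmap c @` _; have oU : open U by exact: open_cimgI.
have UE x : U x -> exists q, [/\ cdom c q, cdom d (F q), cinv c x = q & x = cmap c q].
  by move=> [q [cq dq] <-]; exists q; rewrite cmapK.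
have sU : U `<=` cmap c @` cdom c by move=> x [q [cq _] <-]; exists q.
have JC i j : smooth_on U (fun x => jacobian_in c d x i j) by exact: smooth_jacobian_in.
have GC i j : smooth_on U (fun x => gram_mx g c x i j).
  exact: smooth_on_sub sU (smooth_gram_mx g i j ac).
have GVC i j : smooth_on U (fun x => invmx (gram_mx g c x) i j).
  apply: smooth_on_invmx => // x /UE[q [cq dq _ ->]]; exact: gram_unit.
have JTC i j : smooth_on U (fun x => (jacobian_in c d x)^T i j).
  by under eq_fun do rewrite mxE; exact: JC.
have SC i j : smooth_on U (fun x => cometric c d x i j).
  by apply: smooth_on_mulmx => // k l; apply: smooth_on_mulmx.
have SVC i j : smooth_on U (fun x => invmx (cometric c d x) i j).
  apply: smooth_on_invmx => // x /UE[q [cq dq _ ->]]; exact: cometric_unit.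
have HC i j : smooth_on U (fun x => hproj_mx c d x i j).
  apply: smooth_on_mulmx => // k l; apply: smooth_on_mulmx => // k' l'.
  exact: smooth_on_mulmx.
apply: smooth_on_row => // j.
apply: (@smooth_on_eq _ _ _ _ (fun x =>
  (tcoord c (cinv c x) (X (cinv c x)) *m hproj_mx c d x) 0 j)) => //.
  move=> x /UE[q [cq dq -> ->]].
  have [hu vu] := hproj_mx_split (X q) ac ad cq dq.
  by have [E _] := split_unique hu vu; rewrite /hpart E tvecK.
apply: (@smooth_on_mulmx _ _ _ _ _ _ (fun x => tcoord c (cinv c x) (X (cinv c x)))) => // i k.
have -> : i = 0 by apply: ord1.
exact: (smooth_on_coord k oU (smooth_on_sub sU (XC c ac))).
Qed.

Lemma smooth_vpart (X : vfield M) : smooth_vfield X -> smooth_vfield (vpart g F X).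
Proof.
move=> XC.
have -> : vpart g F X = fun p => X p + (-1) *: hpart g F X p.
  by apply/funext => p; rewrite [X p]hpart_add_vpart scaleN1r addrC addKr.
apply: smooth_vfieldD => //; apply: smooth_vfieldZ; last exact: smooth_hpart.
exact: smooth_fun_cst.
Qed.

End Projections.

(** * Connections and coordinate functions *)
Section Connection.
Context {R : realType} {n : nat} {M : manifold R n}.
Context (nabla : vfield M -> vfield M -> vfield M).
Context (conn : affine_connection nabla).

(** The only linearity available in the first argument concerns combinations
    f X + X', so the zero field is written as -1 * 0 + 0. *)
Lemma connection0l (Y : vfield M) p : smooth_vfield Y -> nabla (fun _ => 0) Y p = 0.
Proof.
move=> YC; have [_ lin _ _] := conn; have C0 := @smooth_vfield0 R n M.
have := lin _ _ _ _ (@smooth_fun_cst R n M (-1)) C0 C0 YC p.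
rewrite (_ : (fun q : M => _) = fun _ => 0); last first.
  by apply/funext => q; rewrite scaler0 addr0.
by rewrite scaleN1r addNr.
Qed.

Lemma connection0r (X : vfield M) p : smooth_vfield X -> nabla X (fun _ => 0) p = 0.
Proof.
move=> XC; have [_ _ add _] := conn; have C0 := @smooth_vfield0 R n M.
have := add _ _ _ XC C0 C0 p.
rewrite (_ : (fun q : M => _) = fun _ => 0); last by apply/funext => q; rewrite addr0.
by rewrite -{1}[nabla X _ p]addr0 => /addrI.
Qed.

End Connection.

Section CoordinateFunctions.
Context {R : realType} {n : nat} {N : manifold R n}.
Implicit Types (q : N) (d : chart R n N).

Lemma dfun_coord (f : N -> R) d q i u : atlas d -> cdom d q -> smooth_fun f ->
  (\forall r \near q, f r = cmap d r 0 i) -> dfun f q u = tcoord d q u 0 i.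
Proof.
move=> ad dq fC fE.
rewrite (dfun_chart _ ad dq (smooth_fun_mdifferentiable _ fC)).
have H : \forall y \near cmap d q, (y : 'rV[R]_n) 0 i = (f \o cinv d) y.
  have H1 := near_cinv dq fE.
  have H2 : \forall y \near cmap d q, (cmap d @` cdom d) y.
    by apply: open_nbhs_nbhs; split; [exact: open_cimg|exact: cimg_map].
  by near=> y; rewrite /= (near H1 y) // cinvK //; near: y.
have [_ E] := near_eq_diff H (differentiable_coord (cmap d q) 0 i).
refine (etrans (congr1 (fun k : 'rV[R]_n -> R => k _) E) _).
have did := is_diff_id (cmap d q).
refine (etrans (diff_coord (f := id) _ _ (@ex_diff _ _ _ _ _ _ _ did)) _).
exact: (congr1 (fun k : 'rV[R]_n -> 'rV[R]_n => k _ 0 i) (@diff_val _ _ _ _ _ _ _ did)).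
Unshelve. all: by end_near. Qed.

Lemma mdifferentiable_gram (h : riemannian N) d q i j : atlas d -> cdom d q ->
  mdifferentiable (fun r => gram_mx h d (cmap d r) i j) q.
Proof.
move=> ad dq; apply: (mdifferentiable_chart ad dq).
have H : \forall y \near cmap d q,
    gram_mx h d y i j = ((fun r => gram_mx h d (cmap d r) i j) \o cinv d) y.
  near=> y; rewrite /= cinvK //; near: y.
  by apply: open_nbhs_nbhs; split; [exact: open_cimg|exact: cimg_map].
have GC := smooth_gram_mx h i j ad.
exact: (near_eq_diff H (smooth_on_differentiable GC (cimg_map dq))).1.
Unshelve. all: by end_near. Qed.

End CoordinateFunctions.

(** * The derivative of the dilation along the fibres *)
Section Conformal.
Context {R : realType} {m n : nat} {M : manifold R m} {N : manifold R n}.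
Context (g : riemannian M) (h : riemannian N).
Context (nabla : vfield M -> vfield M -> vfield M) (F : M -> N) (lambda : M -> R).
Context (LC : levi_civita g nabla).
Context (HC : horizontally_conformal_submersion g h F lambda).

Let FS : submersion F. Proof. by case: HC. Qed.
Let FC : smooth_map F := FS.1.

(** Conformality is assumed on pairs of horizontal vectors; one horizontal
    argument is enough, as a vertical component of the other contributes nothing
    to either side. *)
Lemma conformal_horizontal p u z : horizontal g F p u ->
  h (F p) (dmap F p z) (dmap F p u) = lambda p ^+ 2 * g p z u.
Proof.
move=> hu; have [_ _ _ _ conf] := HC.
have [hz vz _] := orth_proj_split g FS p z; set z' := orth_proj _ _ _ _ in hz vz.
have -> : dmap F p z = dmap F p z'.
  by apply/eqP; rewrite -subr_eq0 -dmapB; apply/eqP.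
rewrite conf //; congr (_ * _).
by apply/esym/eqP; rewrite -subr_eq0 -metricBl Defs.metric_sym hu.
Qed.

Lemma vderiv_comp_vertical (f : N -> R) (V : vfield M) p : mdifferentiable f (F p) ->
  vertical F p (V p) -> vderiv V (f \o F) p = 0.
Proof.
move=> fd vV; rewrite /vderiv (dfun_comp FC (V p) fd).2 vV; exact: linear0.
Qed.

(** The equation lambda^2 g(X, X) = h(F_* X, F_* X) is differentiated along [V]
    in a chart of [N]; see the introduction. *)
Lemma dilation_derivative (V X : vfield M) p :
  smooth_vfield V -> smooth_vfield X ->
  (forall q, vertical F q (V q)) -> (forall q, horizontal g F q (X q)) ->
  dfun lambda p (V p) * g p (X p) (X p) = - lambda p * g p (nabla X V p) (X p).
Proof.
move=> VC XC vV hX; have [_ _ lC l0 conf] := HC; have [conn tf mc] := LC.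
set d := chart_at (F p).
have ad : atlas d := chart_at_atlas (F p); have dp : cdom d (F p) := chart_at_dom (F p).
have [phi phiP] : exists phi : 'I_n -> N -> R, forall i, smooth_fun (phi i) /\
    \forall q \near F p, phi i q = cmap d q 0 i.
  by have [phi phiP] := choice (fun i => coord_extension i ad dp); exists phi.
pose w i := vderiv X (phi i \o F).
have fC i : smooth_fun (phi i \o F) by apply: smooth_fun_comp FC _ (phiP i).1.
have wC i : smooth_fun (w i) by exact: smooth_vderiv.
have wE q i u : cdom d (F q) -> (\forall r \near F q, phi i r = cmap d r 0 i) ->
    dfun (phi i \o F) q u = tcoord d (F q) (dmap F q u) 0 i.
  move=> dq phiq; rewrite (dfun_comp FC u (smooth_fun_mdifferentiable _ (phiP i).1)).2.
  exact: (dfun_coord _ ad dq (phiP i).1 phiq).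
pose H i j (q : N) := gram_mx h d (cmap d q) i j.
have HD i j : mdifferentiable (H i j \o F) p.
  exact: (dfun_comp FC 0 (mdifferentiable_gram h i j ad dp)).1.
have HV i j : dfun (H i j \o F) p (V p) = 0.
  exact: (vderiv_comp_vertical (mdifferentiable_gram h i j ad dp)).
(* Z is the bracket of V and X. *)
pose Z : vfield M := fun q => nabla V X q - nabla X V q.
have wV i : dfun (w i) p (V p) = tcoord d (F p) (dmap F p (Z p)) 0 i.
  rewrite -(wE _ _ _ dp (phiP i).2).
  have := tf V X VC XC (phi i \o F) (fC i) p.
  rewrite (_ : vderiv V (phi i \o F) = fun _ => 0); last first.
    by apply/funext => q; apply: vderiv_comp_vertical => //; exact: smooth_fun_mdifferentiable (phiP i).1.
  have -> : vderiv X (fun _ => 0) p = 0 := dfun_cst 0 p (X p).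
  by rewrite subr0 => bracket; exact: esym bracket.
have near_phi : \forall q \near p, forall i, \forall r \near F q, phi i r = cmap d r 0 i.
  apply: filter_forall => i.
  exact: (near_pre FC (nbhs_interior (phiP i).2)).
pose E q := \sum_i \sum_j w i q * w j q * (H i j \o F) q.
have wD i : mdifferentiable (w i) p by exact: smooth_fun_mdifferentiable.
have wwD i j : mdifferentiable (fun q => w i q * w j q) p by exact: mdifferentiableM.
have tD i j : mdifferentiable (fun q => w i q * w j q * (H i j \o F) q) p by exact: mdifferentiableM.
have lD : mdifferentiable lambda p by exact: smooth_fun_mdifferentiable.
have llD : mdifferentiable (fun q => lambda q * lambda q) p by exact: mdifferentiableM.
have gD : mdifferentiable (fun q => g q (X q) (X q)) p.
  by apply: smooth_fun_mdifferentiable; exact: smooth_metric.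
(* E is h(F_* X, F_* X) near p, where the functions phi i are the coordinates
   of the chart. *)
have key : \forall q \near p, E q = lambda q * lambda q * g q (X q) (X q).
  near=> q.
  have dq : cdom d (F q) by near: q; apply: (near_pre FC); exact: near_cdom.
  have phiq : forall i, \forall r \near F q, phi i r = cmap d r 0 i.
    by near: q; exact: near_phi.
  rewrite -expr2 -conf // (metric_gram _ _ _ ad dq).
  by apply: eq_bigr => i _; apply: eq_bigr => j _; rewrite /w /vderiv !wE.
have ED : mdifferentiable E p by apply: mdifferentiable_sum => i; exact: mdifferentiable_sum.
have [_ key'] := dfun_near (V p) key ED.
have EV : dfun E p (V p) = 2%:R * lambda p ^+ 2 * g p (Z p) (X p).
  transitivity (h (F p) (dmap F p (Z p)) (dmap F p (X p)) +
                h (F p) (dmap F p (X p)) (dmap F p (Z p))); last first.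
    by rewrite [X in _ + X]Defs.metric_sym conformal_horizontal //; ring.
  rewrite !(metric_gram _ _ _ ad dp) -big_split dfun_sum => [|i]; last exact: mdifferentiable_sum.
  apply: eq_bigr => i _; rewrite -big_split dfun_sum //.
  apply: eq_bigr => j _; rewrite !dfunM // HV !wV.
  rewrite -!(wE _ _ _ dp (phiP _).2) /= -/(H i j (F p)) /w /vderiv.
  move: (dfun (phi i \o F) p (X p)) (dfun (phi j \o F) p (X p)).
  move: (dfun (phi i \o F) p (Z p)) (dfun (phi j \o F) p (Z p)) (H i j (F p)).
  by move=> zi zj Hij xi xj; ring.
move: key'; rewrite EV !dfunM //.
have -> : dfun (fun q => g q (X q) (X q)) p (V p) =
    g p (nabla V X p) (X p) + g p (X p) (nabla V X p) by exact: mc.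
rewrite (Defs.metric_sym g p (X p) (nabla V X p)) /Z metricBl => key'.
have l0' : lambda p != 0 by rewrite gt_eqF.
apply: (mulfI l0'); move: key'.
move: (g p (nabla V X p) (X p)) (g p (nabla X V p) (X p)) (g p (X p) (X p)).
move: (dfun lambda p (V p)) (lambda p) => dl l a b c key'.
lra.
Unshelve. all: by end_near. Qed.

End Conformal.

(** * Nilpotency of A on the horizontal space *)
Theorem theorem3p4 (R : realType) (m n : nat) (n_gt0 : (0 < n)%N)
    (M : manifold R m) (N : manifold R n)
    (g : riemannian M) (h : riemannian N)
    (nabla : vfield M -> vfield M -> vfield M) (F : M -> N)
    (lambda : M -> R) :
  levi_civita g nabla ->
  horizontally_conformal_submersion g h F lambda ->
  parallel_tensor nabla (oneill_A g F nabla) ->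
  constant_on_kernel F lambda.
Proof.
move=> LC HC par p v vv.
have [conn _ _] := LC; have [nC _ _ _] := conn; have [FS _ _ l0 _] := HC.
have [V0 [V0C V0p]] := vector_extension p v.
pose V := vpart g F V0.
have VC : smooth_vfield V by exact: smooth_vpart.
have vV q : vertical F q (V q) by exact: vertical_vpart.
have Vp : V p = v.
  have vV0 : vertical F p (V0 p) by rewrite V0p.
  by rewrite -V0p; have [] := split_vertical g vV0.
have hV : hpart g F V = fun _ => 0.
  by apply/funext => q; have [] := split_vertical g (vV q).
have vVE : vpart g F V = V.
  by apply/funext => q; have [] := split_vertical g (vV q).
have h0 : hpart g F (fun _ => 0) = fun _ => 0.
  by apply/funext => q; have [] := split_vertical (X := fun _ => 0) g (dmap0 F q).
have v0 : vpart g F (fun _ => 0) = fun _ => 0.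
  by apply/funext => q; have [] := split_vertical (X := fun _ => 0) g (dmap0 F q).
have n0l Y : smooth_vfield Y -> nabla (fun _ => 0) Y = fun _ => 0.
  by move=> YC; apply/funext => q; exact: connection0l.
have n0r Y : smooth_vfield Y -> nabla Y (fun _ => 0) = fun _ => 0.
  by move=> YC; apply/funext => q; exact: connection0r.
have AV Z : smooth_vfield Z -> oneill_A g F nabla V Z = fun _ => 0.
  move=> ZC; apply/funext => q; rewrite /oneill_A hV.
  by rewrite !n0l ?h0 ?v0 ?addr0 //; [exact: smooth_hpart|exact: smooth_vpart].
pose T X := hpart g F (nabla X V).
have TC X : smooth_vfield X -> smooth_vfield (T X).
  by move=> XC; apply: smooth_hpart => //; exact: nC.
(* T (T X) is - (nabla_X A)_V V. *)
have TT X : smooth_vfield X -> T (T X) p = 0.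
  move=> XC; have ZC := nC _ _ XC VC.
  have := par X V V XC VC VC p; rewrite /cov_deriv !AV // n0r // sub0r subr0.
  rewrite /oneill_A vVE hV n0r ?v0 ?addr0; last exact: TC.
  by move/eqP; rewrite oppr_eq0 => /eqP.
have gT X q : (forall r, horizontal g F r (X r)) ->
    g q (nabla X V q) (X q) = g q (T X q) (X q).
  move=> hX; rewrite [nabla X V q](hpart_add_vpart g FS) metricDl.
  by rewrite [X in _ + X]Defs.metric_sym hX ?addr0 //; exact: vertical_vpart.
apply/eqP; apply: contraT => dl0.
(* Injectivity of T at p, from the quadratic form of T. *)
have zero X : smooth_vfield X -> (forall r, horizontal g F r (X r)) ->
    T X p = 0 -> X p = 0.
  move=> XC hX TX; apply: (metric_eq0 (g := g) (p := p)).
  have := dilation_derivative LC HC p VC XC vV hX.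
  rewrite gT // TX metric0l mulr0 Vp => /eqP; rewrite mulf_eq0 (negPf dl0) /=.
  by move/eqP.
(* Any nonzero vector of the target serves, such as the row of ones. *)
have [u uE] := FS.2 p (const_mx 1).
have [X0 [X0C X0p]] := vector_extension p u.
pose X := hpart g F X0.
have XC : smooth_vfield X by exact: smooth_hpart.
have hX r : horizontal g F r (X r) by exact: horizontal_hpart.
have hT r : horizontal g F r (T X r) by exact: horizontal_hpart.
have Xp : X p = 0 := zero X XC hX (zero (T X) (TC _ XC) hT (TT _ XC)).
have := uE; rewrite -X0p (hpart_add_vpart g FS X0 p) -/X Xp add0r.
have -> := vertical_vpart g FS X0 p.
move/rowP/(_ (Ordinal n_gt0)); rewrite !mxE => /eqP.
by rewrite eq_sym oner_eq0.
Qed.
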